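(* Let $\mathcal{X}$ be a locally compact Polish space and let $\beta$ be the strict topology on $C_b(\mathcal{X})$. (1) Let $\{S(t)\}_{t \geq 0}$ be a SCLE semigroup on $(C_b(\mathcal{X}),\beta)$ such that $S(t) C_0(\mathcal{X}) \subseteq C_0(\mathcal{X})$ for every $t \geq 0$. Then the restriction of the semigroup to $C_0(\mathcal{X})$, denoted by $\{\tilde{S}(t)\}_{t \geq 0}$, is a strongly continuous semigroup on $(C_0(\mathcal{X}),\|\cdot\|)$. (2) Conversely, suppose that $\{\tilde{S}(t)\}_{t \geq 0}$ is a strongly continuous semigroup on $(C_0(\mathcal{X}),\|\cdot\|)$ such that $\tilde{S}'(t)\mathcal{P}(\mathcal{X}) \subseteq \mathcal{P}(\mathcal{X})$ for every $t \geq 0$. Then $\{\tilde{S}(t)\}_{t \geq 0}$ can be extended uniquely to a SCLE semigroup $\{S(t)\}_{t \geq 0}$ on $(C_b(\mathcal{X}),\beta)$. (3) In either of these situations, denote by $(A,\mathcal{D}(A))$ the generator of $\{S(t)\}_{t \geq 0}$ on $(C_b(\mathcal{X}),\beta)$ and by $(\tilde{A},\mathcal{D}(\tilde{A}))$ the generator of $\{\tilde{S}(t)\}_{t \geq 0}$ on $(C_0(\mathcal{X}),\|\cdot\|)$. Then $\tilde{A} \subseteq A$ and $A$ is the $\beta$ closure of $\tilde{A}$.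
   Context: Spaces. $C_b(\mathcal{X})$ is the space of bounded continuous real-valued functions on $\mathcal{X}$; $C_0(\mathcal{X}) \subseteq C_b(\mathcal{X})$ is the subspace of continuous functions that vanish at infinity; $\|\cdot\|$ is the supremum norm. $\mathcal{M}(\mathcal{X})$ is the space of (signed) Radon measures on $\mathcal{X}$ of bounded total variation, which is the continuous dual of $(C_0(\mathcal{X}),\|\cdot\|)$ and of $(C_b(\mathcal{X}),\beta)$; $\mathcal{P}(\mathcal{X}) \subseteq \mathcal{M}(\mathcal{X})$ is the subset of probability measures. $\tilde{S}'(t) : \mathcal{M}(\mathcal{X}) \to \mathcal{M}(\mathcal{X})$ denotes the adjoint of $\tilde{S}(t)$, i.e. $\langle \tilde{S}(t)f, \mu\rangle = \langle f, \tilde{S}'(t)\mu\rangle$ for $f \in C_0(\mathcal{X})$, $\mu \in \mathcal{M}(\mathcal{X})$. Strict topology. The strict topology $\beta$ on $C_b(\mathcal{X})$ is the locally convex topology generated by the semi-norms $$p_{K_n,a_n}(f) := \sup_n a_n \sup_{x \in K_n} |f(x)|,$$ where $(a_n)$ ranges over non-negative sequences converging to $0$ and $(K_n)$ over sequences of compact subsets of $\mathcal{X}$. Semigroups. A family of linear operators $\{T(t)\}_{t \geq 0}$ on $C_b(\mathcal{X})$ is a semigroup if $T(0)$ is the identity and $T(t)T(s) = T(t+s)$ for $s,t \geq 0$. A semigroup of $\beta$-to-$\beta$ continuous operators is strongly continuous if $t \mapsto T(t)f$ is $\beta$-continuous for every $f \in C_b(\mathcal{X})$. The family is locally equi-continuous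 if for every $t \geq 0$ and every $\beta$-continuous semi-norm $p$ on $C_b(\mathcal{X})$ there is a $\beta$-continuous semi-norm $q$ such that $\sup_{s \leq t} p(T(s)f) \leq q(f)$ for every $f \in C_b(\mathcal{X})$. A SCLE semigroup is a semigroup that is both strongly continuous and locally equi-continuous. On the Banach space $(C_0(\mathcal{X}),\|\cdot\|)$, a strongly continuous semigroup is one in the usual sense (bounded linear operators, $t \mapsto \tilde{S}(t)f$ norm continuous for every $f$). Generators. Operators are identified with their graphs. The generator of a SCLE semigroup $\{T(t)\}_{t\geq 0}$ on $(C_b(\mathcal{X}),\beta)$ is the operator $A$ such that $(f,g) \in A$ if and only if $g = \lim_{t \downarrow 0} \frac{T(t)f - f}{t}$ with the limit taken in $\beta$; the generator of a strongly continuous semigroup on $(C_0(\mathcal{X}),\|\cdot\|)$ is defined in the same way with norm limits. $\tilde{A} \subseteq A$ means inclusion of graphs, and the $\beta$ closure of $\tilde{A}$ is the operator whose graph is the closure of the graph of $\tilde{A}$ in $(C_b(\mathcal{X}),\beta) \times (C_b(\mathcal{X}),\beta)$. *)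

(* Defs.v *)
From HB Require Import structures.
From mathcomp Require Import all_boot all_order all_algebra.
From mathcomp Require Import all_classical all_reals all_analysis.

Set Implicit Arguments.
Unset Strict Implicit.
Unset Printing Implicit Defensive.

Import Order.TTheory GRing.Theory Num.Theory.
Import numFieldNormedType.Exports.

Local Open Scope classical_set_scope.
Local Open Scope ring_scope.

Section polish.
Context {R : realType} {X : topologicalType}.
Implicit Type d : X -> X -> R.

Definition is_metric d :=
  [/\ forall x y, 0 <= d x y,
      forall x y, d x y = 0 <-> x = y,
      forall x y, d x y = d y x &
      forall x y z, d x z <= d x y + d y z].

Definition metrizes d := forall x : X,
  nbhs x = filter_from [set e : R | 0 < e] (fun e => [set y | d x y < e]).

Definition complete_metric d := forall u : nat -> X,
  (forall e : R, 0 < e ->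
     exists N, forall m n, (N <= m)%N -> (N <= n)%N -> d (u m) (u n) < e) ->
  exists l : X, u n @[n --> \oo] --> l.

End polish.

Definition polish_space (R : realType) (X : topologicalType) :=
  (exists2 D : set X, countable D & dense D) /\
  (exists d : X -> X -> R, [/\ is_metric d, metrizes d & complete_metric d]).

Section seminorms.
Context {R : realType} {V : lmodType R}.

Definition seminorm (p : V -> R) :=
  (forall f g, p (f + g) <= p f + p g) /\
  (forall (c : R) f, p (c *: f) = `|c| * p f).

(* Finite families are needed since [P] is not assumed to be directed. *)
Definition seminorm_nbhs (P : set (V -> R)) (f : V) : set_system V :=
  [set U | exists n (p : 'I_n -> V -> R) (e : R),
    [/\ forall i, P (p i), 0 < e &
        [set g | forall i, p i (g - f) < e] `<=` U]].

Context (P : set (V -> R)) (Psn : P `<=` seminorm).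

Lemma seminorm0 p : seminorm p -> p 0 = 0.
Proof. by move=> [_ pZ]; rewrite -(scale0r 0) pZ normr0 mul0r. Qed.

Lemma seminorm_nbhs_filter f : ProperFilter (seminorm_nbhs P f).
Proof.
apply: Build_ProperFilter_ex.
  move=> U [n [p [e [Pp e0 pU]]]]; exists f; apply: pU => i /=.
  by rewrite subrr seminorm0//; exact: Psn.
split.
- exists 0%N, (fun=> cst 0), 1; split => //.
  by case.
- move=> U W [m [p [e [Pp e0 pU]]]] [n [q [e' [Pq e'0 qW]]]].
  exists (m + n)%N, (fun i => match fintype.split i with inl j => p j | inr j => q j end).
  exists (Order.min e e'); split => [i||g /= gi]; first by case: (fintype.split i).
    by rewrite lt_min e0.
  split.
    apply: pU => i /=; have := gi (lshift n i).
    by rewrite (unsplitK (inl i : 'I_m + 'I_n)) lt_min => /andP[].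
  apply: qW => i /=; have := gi (rshift m i).
  by rewrite (unsplitK (inr i : 'I_m + 'I_n)) lt_min => /andP[].
- by move=> U W UW [n [p [e [Pp e0 pU]]]]; exists n, p, e; split => // g /pU /UW.
Qed.

Lemma seminorm_nbhs_singleton f U : seminorm_nbhs P f U -> U f.
Proof.
move=> [n [p [e [Pp e0]]]]; apply => i /=.
by rewrite subrr seminorm0//; exact: Psn.
Qed.

Lemma seminorm_nbhs_nbhs f U :
  seminorm_nbhs P f U -> seminorm_nbhs P f (seminorm_nbhs P ^~ U).
Proof.
move=> [n [p [e [Pp e0 pU]]]]; exists n, p, (e / 2).
split; rewrite ?divr_gt0// => g gf; exists n, p, (e / 2).
split; rewrite ?divr_gt0// => h hg; apply: pU => i /=.
have [pD _] := Psn (Pp i).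
rewrite -(subrKA g) (splitr e).
by rewrite (le_lt_trans (pD _ _))// ltrD.
Qed.

End seminorms.

Lemma bounded_funP (T : Type) (R : realType) (f : T -> R) :
  bounded_fun f <-> exists M, forall x, `|f x| <= M.
Proof.
split => [[M [_ fM]]|[M fM]].
  by exists (M + 1) => x; apply: (fM (M + 1)); rewrite ?ltrDl.
exists M; split; first exact: num_real.
by move=> N MN x _ /=; rewrite (le_trans (fM x))// ltW.
Qed.

Section Cb_def.
Context (X : topologicalType) (R : realType).

Definition Cb_pred : {pred X -> R} :=
  mem [set f : X -> R | continuous f /\ bounded_fun f].

Lemma Cb_submod_closed : submod_closed Cb_pred.
Proof.
split => [|a f g]; rewrite !inE.
  split; first exact: cst_continuous.
  by apply/bounded_funP; exists 0 => x /=; rewrite normr0.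
move=> [cf /bounded_funP[M fM]] [cg /bounded_funP[N gN]]; split.
  move=> x; apply: continuousD; last exact: cg.
  by apply: continuousZr; exact: cf.
apply/bounded_funP; exists (`|a| * M + N) => x /=.
rewrite (le_trans (ler_normD _ _))// lerD ?gN//.
by rewrite /GRing.scale/= normrM ler_wpM2l// fM.
Qed.

HB.instance Definition _ :=
  GRing.isSubmodClosed.Build R (X -> R) Cb_pred Cb_submod_closed.

Record Cb := MkCb { Cb_val :> X -> R ; _ : Cb_val \in Cb_pred }.

HB.instance Definition _ := [isSub for Cb_val].
HB.instance Definition _ := [Choice of Cb by <:].
HB.instance Definition _ := [SubChoice_isSubLmodule of Cb by <:].

End Cb_def.

Section sup_on.
Context {X : topologicalType} {R : realType}.
Implicit Types (f g : Cb X R) (K : set X).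

Definition sup_on K f : R := sup [set `|f x| | x in K].

Lemma CbP f : continuous f /\ exists M, forall x, `|f x| <= M.
Proof.
by case: f => f /= + ; rewrite inE => -[cf /bounded_funP].
Qed.

Lemma has_ubound_sup_on K f : has_ubound [set `|f x| | x in K].
Proof.
have [_ [M fM]] := CbP f.
by exists M => _ [x _ <-].
Qed.

Lemma sup_on_ub K f x : K x -> `|f x| <= sup_on K f.
Proof. by move=> Kx; apply: ub_le_sup; [exact: has_ubound_sup_on|exists x]. Qed.

Lemma sup_on_le K f M : 0 <= M -> (forall x, K x -> `|f x| <= M) -> sup_on K f <= M.
Proof.
move=> M0 fM; have [K0|/nonemptyPn K0] := pselect (K !=set0).
  apply: ge_sup; first by case: K0 => x Kx; exists `|f x|; exists x.
  by move=> _ [x Kx <-]; exact: fM.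
by rewrite /sup_on K0 image_set0 sup0.
Qed.

Lemma sup_on_ge0 K f : 0 <= sup_on K f.
Proof.
have [[x Kx]|/nonemptyPn K0] := pselect (K !=set0).
  by rewrite (le_trans _ (sup_on_ub f Kx)).
by rewrite /sup_on K0 image_set0 sup0.
Qed.

Lemma sup_on_seminorm K : seminorm (sup_on K).
Proof.
have sZ (c : R) f : sup_on K (c *: f) <= `|c| * sup_on K f.
  apply: sup_on_le => [|x Kx]; first by rewrite mulr_ge0// sup_on_ge0.
  by rewrite /= normrM ler_wpM2l// sup_on_ub.
split => [f g|c f].
  apply: sup_on_le => [|x Kx]; first by rewrite addr_ge0// sup_on_ge0.
  by rewrite (le_trans (ler_normD _ _))// lerD// sup_on_ub.
apply/eqP; rewrite eq_le sZ/=; have [->|c0] := eqVneq c 0.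
  by rewrite normr0 mul0r sup_on_ge0.
rewrite mulrC -ler_pdivlMr ?normr_gt0// mulrC -normfV.
by rewrite (le_trans _ (sZ _ _))// scalerK.
Qed.

End sup_on.

Section strict.
Context {X : topologicalType} {R : realType}.

Definition strict_seminorm (K : nat -> set X) (a : nat -> R) (f : Cb X R) : R :=
  sup (range (fun n => a n * sup_on (K n) f)).

Definition strict_seminorms : set (Cb X R -> R) :=
  [set p | exists (K : nat -> set X) (a : nat -> R),
    [/\ forall n, compact (K n), forall n, 0 <= a n,
        a n @[n --> \oo] --> 0 & p = strict_seminorm K a]].

Lemma strict_seminormsP : strict_seminorms `<=` seminorm.
Proof.
move=> _ [K [a [_ a0 acv ->]]].
have [A aA] : exists A, forall n, a n <= A.
  have /cvg_seq_bounded/bounded_funP[A aA] : cvgn a by apply/cvg_ex; exists 0.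
  by exists A => n; rewrite (le_trans (ler_norm _))// aA.
have ub f : has_ubound (range (fun n => a n * sup_on (K n) f)).
  have [_ [M fM]] := CbP f.
  exists (A * Num.max 0 M) => _ [n _ <-].
  rewrite ler_pM ?sup_on_ge0//; apply: sup_on_le => [|x _].
    by rewrite le_max lexx.
  by rewrite le_max fM orbT.
have pub f n : a n * sup_on (K n) f <= strict_seminorm K a f.
  by apply: ub_le_sup; [exact: ub|exists n].
have ple f M : (forall n, a n * sup_on (K n) f <= M) -> strict_seminorm K a f <= M.
  move=> fM; apply: ge_sup; first by eexists; exists 0%N.
  by move=> _ [n _ <-].
have p0 f : 0 <= strict_seminorm K a f.
  by rewrite (le_trans _ (pub f 0%N))// mulr_ge0// sup_on_ge0.
have sD n := (sup_on_seminorm (R := R) (K n)).1.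
have sZ n := (sup_on_seminorm (R := R) (K n)).2.
have pZ (c : R) f : strict_seminorm K a (c *: f) <= `|c| * strict_seminorm K a f.
  by apply: ple => n; rewrite sZ mulrCA ler_wpM2l.
split => [f g|c f].
  apply: ple => n; rewrite (le_trans _ (lerD (pub f n) (pub g n)))//.
  by rewrite -mulrDr ler_wpM2l.
apply/eqP; rewrite eq_le pZ/=; have [->|c0] := eqVneq c 0.
  by rewrite normr0 mul0r.
rewrite mulrC -ler_pdivlMr ?normr_gt0// mulrC -normfV.
by rewrite (le_trans _ (pZ _ _))// scalerK.
Qed.

HB.instance Definition _ :=
  hasNbhs.Build (Cb X R) (seminorm_nbhs strict_seminorms).

HB.instance Definition _ := Nbhs_isNbhsTopological.Build (Cb X R)
  (seminorm_nbhs_filter strict_seminormsP)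
  (seminorm_nbhs_singleton strict_seminormsP)
  (seminorm_nbhs_nbhs strict_seminormsP).

End strict.

Section C0_def.
Context (X : topologicalType) (R : realType).

Definition vanishes_at_infinity (f : X -> R) := forall e : R, 0 < e ->
  exists2 K, compact K & forall x, ~ K x -> `|f x| < e.

Definition C0_pred : {pred Cb X R} :=
  mem [set f : Cb X R | vanishes_at_infinity f].

Lemma C0_submod_closed : submod_closed C0_pred.
Proof.
split => [|a f g]; rewrite !inE.
  by move=> e e0; exists set0 => [|x _ /=]; [exact: compact0|rewrite normr0].
move=> f0 g0 e e0.
have a0 : 0 < `|a| + 1 by rewrite ltr_wpDl.
have [|K cK fK] := f0 (e / 2 / (`|a| + 1)); first by rewrite !divr_gt0.
have [|L cL gL] := g0 (e / 2); first by rewrite divr_gt0.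
exists (K `|` L); first exact: compactU.
move=> x /not_orP[/fK fx /gL gx] /=.
rewrite (le_lt_trans (ler_normD _ _))// (splitr e) ltrD//.
rewrite /GRing.scale/= normrM.
move: fx; rewrite ltr_pdivlMr// => /(le_lt_trans _); apply.
by rewrite mulrC ler_wpM2l// lerDl.
Qed.

HB.instance Definition _ :=
  GRing.isSubmodClosed.Build R (Cb X R) C0_pred C0_submod_closed.

Record C0 := MkC0 { C0_val :> Cb X R ; _ : C0_val \in C0_pred }.

HB.instance Definition _ := [isSub for C0_val].
HB.instance Definition _ := [Choice of C0 by <:].
HB.instance Definition _ := [SubChoice_isSubLmodule of C0 by <:].

Definition C0_norm (f : C0) : R := sup_on setT f.

Lemma C0_norm_eq0 (f : C0) : C0_norm f = 0 -> f = 0.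
Proof.
move=> f0; apply/val_inj/val_inj/funext => x /=.
by apply/eqP; rewrite -normr_le0 -f0 sup_on_ub.
Qed.

HB.instance Definition _ := Lmodule_isNormed.Build R C0
  (fun f g => (sup_on_seminorm setT).1 (C0_val f) (C0_val g))
  (fun c f => (sup_on_seminorm setT).2 c (C0_val f))
  C0_norm_eq0.

End C0_def.

Section semigroups.
Context {R : realType}.

Definition semigroup (V : lmodType R) (T : R -> V -> V) :=
  [/\ forall t, 0 <= t -> linear (T t),
      T 0 = id &
      forall s t, 0 <= s -> 0 <= t -> T t \o T s = T (t + s)].

Definition locally_equicontinuous (V : preTopologicalLmodType R)
    (T : R -> V -> V) :=
  forall t : R, 0 <= t -> forall p : V -> R, seminorm p -> continuous p ->
  exists q : V -> R, [/\ seminorm q, continuous q &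
    forall f s, 0 <= s <= t -> p (T s f) <= q f].

Definition SCLE_semigroup (V : preTopologicalLmodType R) (T : R -> V -> V) :=
  [/\ semigroup T,
      forall t, 0 <= t -> continuous (T t),
      forall f, {within [set t | 0 <= t], continuous (T ^~ f)} &
      locally_equicontinuous T].

Definition strongly_continuous_semigroup (V : normedModType R)
    (T : R -> V -> V) :=
  [/\ semigroup T,
      forall t, 0 <= t -> exists M : R, forall f, `|T t f| <= M * `|f| &
      forall f, {within [set t | 0 <= t], continuous (T ^~ f)}].

(* Operators are identified with their graphs. *)
Definition generator (V : preTopologicalLmodType R) (T : R -> V -> V) :
    set (V * V) :=
  [set fg | t^-1 *: (T t fg.1 - fg.1) @[t --> 0^'+] --> fg.2].

End semigroups.

Section radon.
Context {X : topologicalType} {R : realType}.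

(* The measurable types of the library are pointed; the point [x0] only serves
   to see the possibly empty type [X] as one of them: the sigma-algebra does not
   depend on [x0]. *)
Definition pointed_at (x0 : X) : Type := X.

HB.instance Definition _ (x0 : X) := Choice.on (pointed_at x0).
HB.instance Definition _ (x0 : X) := isPointed.Build (pointed_at x0) x0.

Definition borel (x0 : X) :=
  g_sigma_algebraType (@open X : set (set (pointed_at x0))).

Context (x0 : X).
Local Notation measure_on_X := (charge (borel x0) R).
Implicit Types mu nu : measure_on_X.

Lemma hahn_decomposition_ex mu :
  exists PN : set (borel x0) * set (borel x0), hahn_decomposition mu PN.1 PN.2.
Proof. by have [P [N PN]] := Hahn_decomposition mu; exists (P, N). Qed.

Definition hahn mu := projT2 (cid (hahn_decomposition_ex mu)).

(* Charges are finite-valued, hence of bounded total variation; what is left to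
   ask is inner regularity of the total variation. *)
Definition Radon : set measure_on_X :=
  [set mu | forall A : set X, measurable (A : set (borel x0)) ->
    charge_variation (hahn mu) A =
    ereal_sup [set charge_variation (hahn mu) K
              | K in [set K : set X | compact K /\ K `<=` A]]].

Definition Prob : set measure_on_X :=
  [set mu | [/\ Radon mu,
    forall A : set (borel x0), measurable A -> (0 <= mu A)%E & mu setT = 1%E]].

Definition pairing (f : X -> R) mu : R :=
  (\int[jordan_pos (hahn mu)]_x f x) - (\int[jordan_neg (hahn mu)]_x f x).

(* [adjoint T mu] is the Radon measure representing the functional
   [f |-> pairing (T f) mu] on C_0(X). For bounded [T] and Radon [mu] it exists
   and is unique, as a measure on the Borel sets, by the Riesz representation
   theorem; should there be none, the value is the zero measure, which is not in
   [Prob]. *)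
Definition adjoint (T : C0 X R -> C0 X R) mu : measure_on_X :=
  if pselect (exists nu, Radon nu /\
                forall f : C0 X R, pairing (T f) mu = pairing f nu)
    is left h then projT1 (cid h) else czero.

End radon.

Definition adjoint_preserves_Prob (X : topologicalType) (R : realType)
    (T : R -> C0 X R -> C0 X R) :=
  forall (x0 : X) (t : R), 0 <= t ->
    adjoint (T t) @` @Prob X R x0 `<=` @Prob X R x0.

Section restriction.
Context {X : topologicalType} {R : realType}.

Definition preserves_C0 (S : R -> Cb X R -> Cb X R) :=
  forall t, 0 <= t -> forall f, f \in @C0_pred X R -> S t f \in @C0_pred X R.

(* [insubd 0 g] is [g] seen in [C0 X R] when [g] vanishes at infinity, the only
   case of interest. *)
Definition C0_restriction (S : R -> Cb X R -> Cb X R) :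
    R -> C0 X R -> C0 X R :=
  fun t f => insubd (0 : C0 X R) (S t (C0_val f)).

Definition extends (S : R -> Cb X R -> Cb X R) (T : R -> C0 X R -> C0 X R) :=
  forall t, 0 <= t -> forall f : C0 X R, S t (C0_val f) = C0_val (T t f).

Definition Cb_graph (A : set (C0 X R * C0 X R)) : set (Cb X R * Cb X R) :=
  [set (C0_val fg.1, C0_val fg.2) | fg in A].

End restriction.

(* Main.v *)
Require Import Defs.
From mathcomp Require Import all_boot all_order all_algebra.
From mathcomp Require Import all_classical all_reals all_analysis.
From mathcomp Require Import ring lra.
From mathcomp Require Import measurable_realfun.

Set Implicit Arguments.
Unset Strict Implicit.
Unset Printing Implicit Defensive.

Import Order.TTheory GRing.Theory Num.Theory.
Import numFieldNormedType.Exports.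
Local Open Scope classical_set_scope.
Local Open Scope ring_scope.

(** The strict topology on [C_b(X)] is handled through the seminorms that are
    continuous for it. These are exactly the seminorms [p] that are bounded by a
    multiple of the supremum norm and such that, for every [e > 0], there is a
    compact set [K] with [p g <= e ||g|| ] for all [g] vanishing on [K]
    ([tight_dominated], [continuous_tight]); such a seminorm is called tight. On
    bounded sets a tight seminorm only sees locally uniform convergence, so that
    for the cutoff functions [chi n] of an exhaustion of [X] by compact sets,
    [f chi n] tends to [f] strictly: [C_0(X)] is strictly dense.

    The generator of the restriction [T] of [S] is a core. If [(f, g)] is in the generator
    of [S], the mean value inequality
    [p (S t f - f - t g') <= t sup_(s <= t) p (S s g - g')] holds
    ([semigroup_mean_value]). It is preserved under strict limits of [(f, g)],
    so the generator is strictly closed. Conversely, for [(f, g)] in the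
    generator of [S], let [k] be the mean over [0, r] of the orbit of [f chi n]
    in [C_0(X)]. Then [k] is in the domain of the generator of [T], which maps it
    to [(T r (f chi n) - f chi n) / r] ([generator_average]). For small [r] and
    then large [n], the first is close to [f] and the second to [g]. The mean is
    obtained as a limit of averages over dyadic times.

    The restriction is strongly continuous. Orbits in [C_0(X)] are locally
    bounded, and continuous for locally uniform convergence. By a sliding hump, a bounded sequence in
    [C_0(X)] that converges locally uniformly has averages that converge in norm
    ([sliding_hump]). Hence an orbit stays in a norm separable set, and Baire's
    theorem provides an interval of times on which its oscillation is small; the
    semigroup property propagates this to later times. Thus [T c f] is a point of
    norm continuity for [c > 0], and so is [f], as a norm limit of averages of the
    [T (1 / n) f].

    Extension to [C_b(X)]. Applied to Dirac masses, the hypothesis on the adjoint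
    says that [f |-> T t f x] is the integral against a probability measure. Thus
    [T t] is positive and [T t (chi n) x] increases to [1], uniformly on compact
    sets of pairs [(t, x)] by Dini's argument ([conservative_locally_uniform]).
    Then [T t (f chi n)] converges locally uniformly, and its limit [S t f]
    satisfies [ |S t f| <= ||f|| (1 - T t (chi n)) ] when [f] vanishes on the
    support of [chi n]. Therefore [sup_(s <= t) p (S s f)] is tight when [p] is,
    which is local equicontinuity; everything else follows from the density of
    [C_0(X)]. *)

(** * Function spaces *)

Notation supn f := (sup_on setT f).

Section function_spaces.
Context {X : topologicalType} {R : realType}.
Implicit Types (f g : Cb X R) (h k : C0 X R).

Lemma ler_supn f x : `|f x| <= supn f.
Proof. exact: sup_on_ub. Qed.

Lemma supn_le f M : 0 <= M -> (forall x, `|f x| <= M) -> supn f <= M.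
Proof. by move=> M0 fM; apply: sup_on_le. Qed.

Lemma ler_C0_norm h x : `|h x| <= `|h|.
Proof. exact: ler_supn. Qed.

Lemma C0_norm_le h M : 0 <= M -> (forall x, `|h x| <= M) -> `|h| <= M.
Proof. exact: supn_le. Qed.

Lemma Cb_exists (f : X -> R) : continuous f -> (exists M, forall x, `|f x| <= M) ->
  exists g : Cb X R, forall x, g x = f x.
Proof.
move=> cf /Defs.bounded_funP bf.
have fP : f \in @Cb_pred X R by rewrite inE.
by exists (MkCb fP).
Qed.

Lemma C0_exists (f : X -> R) : continuous f -> (exists M, forall x, `|f x| <= M) ->
  vanishes_at_infinity f -> exists g : C0 X R, forall x, g x = f x.
Proof.
move=> cf bf vf; have [g gE] := Cb_exists cf bf.
have gP : g \in @C0_pred X R.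
  by rewrite inE /=; move: vf; congr vanishes_at_infinity; apply/funext => x.
by exists (MkC0 gP).
Qed.

Lemma Cb_continuous f : continuous f.
Proof. by have [] := CbP f. Qed.

Lemma C0_vanish h : vanishes_at_infinity h.
Proof. by case: h => h /=; rewrite inE. Qed.

Lemma Cb_ext f g : (forall x, f x = g x) -> f = g.
Proof. by move=> fg; apply/val_inj/funext. Qed.

Lemma C0_ext h k : (forall x, h x = k x) -> h = k.
Proof. by move=> fg; apply/val_inj/Cb_ext. Qed.

Lemma locally_uniform_limit_continuous (f : X -> R) :
  (forall x e, 0 < e -> exists2 g : X -> R, {for x, continuous g} &
     \forall y \near x, `|f y - g y| <= e) -> continuous f.
Proof.
move=> fg x; apply/cvgrPdist_lt => e e0.
have [|g cg fge] := fg x (e / 4); first by rewrite divr_gt0.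
have /cvgrPdist_lt/(_ (e / 4)) := cg; rewrite divr_gt0// => /(_ isT) gx.
have fgx := nbhs_singleton fge.
near=> y.
have fgy : `|f y - g y| <= e / 4 by near: y.
have gxy : `|g x - g y| < e / 4 by near: y.
move: fgx fgy gxy; rewrite !ler_norml !ltr_norml => /andP[? ?] /andP[? ?] /andP[? ?].
by apply/andP; split; lra.
Unshelve. all: by end_near. Qed.

Lemma C0_complete (u : nat -> C0 X R) :
  (forall e, 0 < e -> exists N, forall m n, (N <= m)%N -> (N <= n)%N -> `|u m - u n| <= e) ->
  exists l : C0 X R, forall e, 0 < e ->
    exists N, forall n, (N <= n)%N -> `|u n - l| <= e.
Proof.
move=> uC.
have ptw x : cvgn (fun n => u n x).
  apply/cauchy_cvgP/cauchy_exP => e e0.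
  have [|N uN] := uC (e / 2); first by rewrite divr_gt0.
  exists (u N x); exists N => // n /= Nn; rewrite -ball_normE /=.
  apply: le_lt_trans (ler_C0_norm (u N - u n) x) _.
  by apply: le_lt_trans (uN _ _ _ _) _ => //; rewrite ltr_pdivrMr// ltr_pMr// ltr1n.
pose l x : R := limn (fun n => u n x).
have ul e : 0 < e -> exists N, forall n, (N <= n)%N -> forall x, `|u n x - l x| <= e.
  move=> e0; have [N uN] := uC _ e0; exists N => n Nn x.
  have cv : `|u n x - u m x| @[m --> \oo] --> `|u n x - l x|.
    by apply: cvg_norm; apply: cvgB; [exact: cvg_cst|exact: ptw].
  apply: (cvgr_to_le cv); exists N => // m /= Nm.
  exact: le_trans (ler_C0_norm (u n - u m) x) (uN _ _ _ _).
have lc : continuous l.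
  apply: locally_uniform_limit_continuous => x e e0.
  have [N uN] := ul _ e0; exists (u N); first exact: Cb_continuous.
  by near=> y; rewrite distrC uN.
have lb : exists M, forall x, `|l x| <= M.
  have [N uN] := ul _ ltr01; exists (`|u N| + 1) => x.
  have := ler_C0_norm (u N) x; have := uN _ (leqnn N) x.
  by rewrite !ler_norml => /andP[? ?] /andP[? ?]; apply/andP; split; lra.
have l0 : vanishes_at_infinity l.
  move=> e e0; have [|N uN] := ul (e / 2); first by rewrite divr_gt0.
  have [|K cK uK] := @C0_vanish (u N) (e / 2); first by rewrite divr_gt0.
  exists K => // x /uK; have := uN _ (leqnn N) x.
  by rewrite ler_norml !ltr_norml => /andP[? ?] /andP[? ?]; apply/andP; split; lra.
have [k kE] := C0_exists lc lb l0.
exists k => e e0; have [N uN] := ul _ e0; exists N => n Nn.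
by apply: C0_norm_le (ltW e0) _ => x; rewrite [X in `|X|](_ : _ = u n x - k x)// kE; exact: uN.
Unshelve. all: by end_near. Qed.

Lemma mulC0_subproof f h : exists k : C0 X R, forall x, k x = f x * h x.
Proof.
apply: (C0_exists (f := fun x => f x * h x)).
- by move=> x; apply: continuousM; exact: Cb_continuous.
- exists (supn f * `|h|) => x; rewrite normrM ler_pM ?ler_supn//; exact: ler_C0_norm.
- move=> e e0; have f0 : 0 < supn f + 1 by rewrite ltr_wpDl// sup_on_ge0.
  have [|K cK hK] := @C0_vanish h (e / (supn f + 1)); first by rewrite divr_gt0.
  exists K => // x /hK; rewrite normrM ltr_pdivlMr// => /(le_lt_trans _); apply.
  by rewrite mulrC ler_wpM2l// (le_trans (ler_supn f x))// lerDl.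
Qed.

Definition mulC0 f h : C0 X R := projT1 (cid (mulC0_subproof f h)).

Lemma mulC0E f h x : mulC0 f h x = f x * h x.
Proof. by rewrite /mulC0; case: cid => k /= ->. Qed.

End function_spaces.

(** * Cutoff functions *)

Lemma half_expn_le (R : realType) (e : R) : 0 < e -> exists N, 2^-1 ^+ N <= e.
Proof.
move=> e0; have := @cvg_expr R 2^-1; rewrite ger0_norm ?invr_ge0//.
rewrite invf_lt1// ltr1n => /(_ isT)/cvgrPdist_le/(_ _ e0)[N _ /(_ _ (leqnn N))] /=.
by rewrite sub0r normrN ger0_norm ?exprn_ge0 ?invr_ge0// => ?; exists N.
Qed.

Lemma half_expn_small (R : realType) (r e : R) : 0 < e ->
  exists m, forall n, (m <= n)%N -> r / 2 ^+ n < e.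
Proof.
move=> e0; have r1 : 0 < `|r| + 1 by rewrite ltr_wpDl.
have [|m me] := @half_expn_le R (e / (`|r| + 1)); first by rewrite divr_gt0.
exists m => n mn; rewrite -exprVn (@le_lt_trans _ _ (`|r| * 2^-1 ^+ n))//.
  by rewrite ler_wpM2r ?ler_norm// exprn_ge0.
apply: (@lt_le_trans _ _ ((`|r| + 1) * 2^-1 ^+ n)).
  by rewrite ltr_pM2r ?ltrDl// exprn_gt0.
rewrite mulrC -ler_pdivlMr// (le_trans _ me)//.
by rewrite ler_wiXn2l ?invr_ge0// invf_le1// ler1n.
Qed.

Lemma exprK_half (R : realType) n (r : R) : 2 ^+ n * (r / 2 ^+ n) = r.
Proof. by rewrite mulrC divfK// expf_neq0. Qed.

Lemma half_split (R : realType) m b (r : R) : 2 ^+ b * (r / 2 ^+ (m + b)) = r / 2 ^+ m.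
Proof.
have p2 n : (2 : R) ^+ n != 0 by rewrite expf_neq0.
by rewrite exprD; field; rewrite !p2.
Qed.

Lemma inv_succ_le (R : realType) (e : R) : 0 < e -> exists N, N.+1%:R^-1 <= e.
Proof.
move=> e0; have /archi_boundP : 0 <= e^-1 by rewrite invr_ge0 ltW.
set N := Num.bound _ => eN; exists N.
rewrite -[leRHS]invrK lef_pV2 ?posrE ?invr_gt0// (le_trans (ltW eN))//.
by rewrite ler_nat.
Qed.

Section cutoffs.
Context {X : topologicalType} {R : realType}.

Lemma C0_geometric_limit (u : nat -> C0 X R) :
  (forall n, `|u n.+1 - u n| <= 2^-1 ^+ n) ->
  exists l : C0 X R, forall e, 0 < e ->
    exists N, forall n, (N <= n)%N -> `|u n - l| <= e.
Proof.
move=> uS; apply: C0_complete => e e0.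
have [|N Ne] := @half_expn_le R (e / 4); first by rewrite divr_gt0.
have uN k : `|u (N + k)%N - u N| <= 2 * 2^-1 ^+ N - 2 * 2^-1 ^+ (N + k).
  elim: k => [|k IH]; first by rewrite addn0 !subrr normr0.
  rewrite -(subrK (u (N + k)%N) (u (N + k.+1)%N)) -addrA (le_trans (ler_normD _ _))//.
  rewrite addnS exprS; have := uS (N + k)%N; move: IH; lra.
have uN' n : (N <= n)%N -> `|u n - u N| <= e / 2.
  move=> /subnKC <-; apply: le_trans (uN _) _.
  have : 0 <= (2^-1 : R) ^+ (N + (n - N)) by rewrite exprn_ge0// invr_ge0.
  by move: Ne; lra.
exists N => m n Nm Nn; rewrite -(subrKA (u N)) (le_trans (ler_normD _ _))//.
by rewrite [`|u N - _|]distrC (splitr e) lerD// uN'.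
Qed.

Lemma metric_continuous (d : X -> X -> R) q : is_metric d -> metrizes d ->
  continuous (d q).
Proof.
move=> [_ _ dC dD] dn x; apply/cvgrPdist_lt => e e0.
have : nbhs x [set y | d x y < e] by rewrite dn; exists e.
apply: filterS => y /= xy.
have := dD q x y; have := dD q y x; rewrite (dC y x) => ? ?.
by rewrite ltr_norml; apply/andP; split; lra.
Qed.

Lemma locally_compact_nbhs : locally_compact [set: X] ->
  forall x : X, exists2 K, compact K & nbhs x K.
Proof.
move=> lc x; have [K xK [cK _]] := lc x I; exists K => //.
by move: xK; rewrite /within/=; apply: filterS => y yK; exact: yK.
Qed.

(** The ball need not be relatively compact: in that case [h = 0] does, so that
    the bumps can be indexed by all centres and radii. *)
Lemma bump_exists (d : X -> X -> R) q k : is_metric d -> metrizes d ->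
  exists h : C0 X R, (forall x, 0 <= h x <= 1) /\
    ((exists2 K, compact K & [set x | d q x < k.+1%:R^-1] `<=` K) ->
     forall x, d q x < k.+1%:R^-1 -> 0 < h x).
Proof.
move=> dm dn; have [d0 _ _ _] := dm.
have k1 : (k.+1%:R^-1 : R) <= 1 by rewrite invf_le1// ler1n.
have [[K cK bK]|nK] := pselect (exists2 K, compact K & [set x | d q x < k.+1%:R^-1] `<=` K).
  pose f x : R := Num.max 0 (k.+1%:R^-1 - d q x).
  have f01 x : 0 <= f x <= 1.
    rewrite /f le_max lexx ge_max ler01/= (le_trans _ k1)// lerBlDr lerDl.
    exact: d0.
  have [h hE] : exists h : C0 X R, forall x, h x = f x.
    apply: C0_exists.
    - move=> x; apply: (@continuous_max R X (fun=> 0) (fun y => k.+1%:R^-1 - d q y)).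
        exact: cvg_cst.
      by apply: continuousB; [exact: cvg_cst|exact: metric_continuous].
    - by exists 1 => x; have /andP[? ?] := f01 x; rewrite ger0_norm.
    - move=> e e0; exists K => // x /(contra_not (bK x))/= /negP.
      by rewrite -leNgt /f -subr_le0 => /max_idPl ->; rewrite normr0.
  exists h; split=> [x|_ x dqx]; rewrite hE; first exact: f01.
  by rewrite /f lt_max subr_gt0 dqx orbT.
by exists 0; split => [x|/nK//] /=; rewrite lexx ler01.
Qed.

(** Sum, with weights [2 ^- j], of the bumps on the relatively compact balls of
    radius [1 / (k + 1)] centred in a countable dense set; by local compactness
    these balls cover the space. *)
Lemma positive_C0_exists : polish_space R X -> locally_compact [set: X] ->
  exists psi : C0 X R, forall x, 0 < psi x.
Proof.
move=> [[D /countable_injP[c ic] dD] [d [dm dn _]]] lc.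
have phiP j : exists h : C0 X R, (forall x, 0 <= h x <= 1) /\
    forall q k, q \in D -> unpickle j = Some (c q, k) ->
    (exists2 K, compact K & [set x | d q x < k.+1%:R^-1] `<=` K) ->
     forall x, d q x < k.+1%:R^-1 -> 0 < h x.
  have [[[q k] [qD jE]]|nj] := pselect (exists qk : X * nat,
      qk.1 \in D /\ unpickle j = Some (c qk.1, qk.2)).
    have [h [h01 hP]] := bump_exists q k dm dn; exists h; split => // q' k' q'D.
    by rewrite jE => -[/(ic q q' qD q'D) <- <-].
  exists 0; split => [x|q k qD jE]; first by rewrite lexx ler01.
  by case: nj; exists (q, k).
pose phi j := projT1 (cid (phiP j)).
have phi01 j x : 0 <= phi j x <= 1 by rewrite /phi; case: cid => ? [].
have phi0 j x : 0 <= phi j x by have /andP[] := phi01 j x.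
pose s n : C0 X R := \sum_(j < n) (2^-1 ^+ j *: phi j).
have sE n x : s n x = \sum_(j < n) (2^-1 ^+ j * phi j x).
  rewrite /s; elim/big_ind2 : _ => [//|f1 x1 f2 x2 <- <-//|//].
have [|psi psiP] := @C0_geometric_limit s.
  move=> n; rewrite {1}/s big_ord_recr/= addrAC subrr add0r normrZ ger0_norm ?exprn_ge0//.
  rewrite -[leRHS]mulr1 ler_wpM2l ?exprn_ge0// C0_norm_le// => x.
  by rewrite ger0_norm//; have /andP[] := phi01 n x.
exists psi => x.
have [q [k [qD [K cK dK] dqx]]] : exists q k, [/\ q \in D,
    exists2 K, compact K & [set x | d q x < k.+1%:R^-1] `<=` K & d q x < k.+1%:R^-1].
  have [K cK] := locally_compact_nbhs lc x; rewrite dn => -[e /= e0 eK].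
  have [|k ke] := @inv_succ_le R (e / 2); first by rewrite divr_gt0.
  have [d0 d1 dC dT] := dm.
  have xk : nbhs x [set y | d x y < k.+1%:R^-1] by rewrite dn; exists k.+1%:R^-1 => /=.
  have [|q [qk qD]] := dD [set y | d x y < k.+1%:R^-1]^° _ (@open_interior _ _).
    by exists x; exact: xk.
  have {}qk := interior_subset qk.
  exists q, k; split; [by rewrite inE| |by rewrite dC].
  exists K => // y /= qy; apply: eK => /=; rewrite (le_lt_trans (dT x q y))//.
  by move: qk qy ke => /=; move: (k.+1%:R^-1) => z; lra.
pose j := pickle (c q, k).
have phij : 0 < phi j x.
  rewrite /phi; case: cid => h /= [h01 hP]; apply: (hP q k) => //.
    by rewrite /j pickleK.
  by exists K.
have cj : 0 < (2^-1 ^+ j : R) * phi j x by rewrite mulr_gt0// exprn_gt0// invr_gt0.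
have [|N sN] := psiP (2^-1 ^+ j * phi j x / 2); first by rewrite divr_gt0.
pose M := (maxn N j.+1).
have := le_trans (ler_C0_norm (s M - psi) x) (sN M (leq_maxl _ _)).
rewrite [X in `|X|](_ : _ = s M x - psi x)// ler_norml => /andP[_].
suff : 2^-1 ^+ j * phi j x <= s M x by move: cj; lra.
have jM : (j < M)%N by exact: leq_maxr.
rewrite sE (bigD1 (Ordinal jM))//= lerDl sumr_ge0// => i _.
by rewrite mulr_ge0// exprn_ge0// invr_ge0.
Qed.

(** An exhaustion of the space by compact sets, expressed by functions. *)
Definition cutoffs (chi : nat -> C0 X R) :=
  [/\ forall n x, 0 <= chi n x <= 1,
      forall m n, (m <= n)%N -> forall x, chi m x <= chi n x,
      forall n, exists2 K, compact K & forall x, ~ K x -> chi n x = 0 &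
      forall K, compact K -> exists N, forall n, (N <= n)%N -> forall x, K x -> chi n x = 1].

(** Truncate [n psi - 1] between [0] and [1]: the result vanishes where
    [psi <= 1 / n] and equals [1] where [psi >= 2 / n], hence on a given compact
    set for large [n], as [psi] has a positive minimum there. *)
Lemma cutoffs_exist : polish_space R X -> locally_compact [set: X] ->
  exists chi, cutoffs chi.
Proof.
move=> Xp Xlc; have [psi psi0] := positive_C0_exists Xp Xlc.
pose f n x : R := Num.min 1 (Num.max 0 (n%:R * psi x - 1)).
have f01 n x : 0 <= f n x <= 1.
  by rewrite /f le_min ler01 le_max lexx ge_min lexx.
have fC0 n : exists2 K, compact K & forall x, ~ K x -> f n x = 0.
  have [|K cK psiK] := @C0_vanish _ _ psi (n.+1%:R^-1); first by rewrite invr_gt0.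
  exists K => // x /psiK; rewrite gtr0_norm// /f => px.
  suff /max_idPl -> : n%:R * psi x - 1 <= 0 by exact/min_idPr.
  have : n.+1%:R * psi x < 1 by rewrite mulrC -ltr_pdivlMr// div1r.
  by rewrite -natr1 mulrDl mul1r; have := psi0 x; lra.
have /choice[chi chiE] n : exists h : C0 X R, forall x, h x = f n x.
  apply: C0_exists.
  - move=> x; apply: (@continuous_min R X (fun=> 1)
      (fun y => Num.max 0 (n%:R * psi y - 1))); first exact: cvg_cst.
    apply: (@continuous_max R X (fun=> 0) (fun y => n%:R * psi y - 1)).
      exact: cvg_cst.
    apply: continuousB; last exact: cvg_cst.
    by apply: continuousM; [exact: cvg_cst|exact: Cb_continuous].
  - by exists 1 => x; have /andP[? ?] := f01 n x; rewrite ger0_norm.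
  - move=> e e0; have [K cK fK] := fC0 n; exists K => // x /fK ->.
    by rewrite normr0.
exists chi; split.
- by move=> n x; rewrite chiE.
- move=> m n mn x; rewrite !chiE /f le_min ge_min lexx/= ge_min.
  apply/orP; right; rewrite ge_max !le_max lexx/=; apply/orP; right.
  by rewrite lerB// ler_wpM2r ?ler_nat// ltW.
- by move=> n; have [K cK fK] := fC0 n; exists K => // x /fK <-.
- move=> K cK; have [K0|/nonemptyPn K0] := pselect (K !=set0); last first.
    by exists 0%N => n _ x; rewrite K0.
  have [|c cK' cmin] := compact_EVT_min K0 cK (f := psi).
    by apply: continuous_subspaceT; exact: Cb_continuous.
  have [|N Nc] := @inv_succ_le R (psi c / 2); first by rewrite divr_gt0.
  exists N.+1 => n Nn x Kx; rewrite chiE.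
  suff n2 : 2 <= n%:R * psi x.
    by apply/min_idPl; rewrite le_max; apply/orP; right; move: n2; lra.
  have : 2 <= N.+1%:R * psi c.
    by move: Nc; rewrite ler_pdivlMr// ler_pdivrMl.
  move=> /le_trans; apply; rewrite ler_pM ?ler_nat//; first exact: ltW.
  by apply: cmin; rewrite inE.
Qed.

End cutoffs.

(** * Seminorms and the strict topology *)

Section seminorm_theory.
Context {R : realType} {V : lmodType R} (p : V -> R).
Context (sp : seminorm p).

Lemma seminormN f : p (- f) = p f.
Proof. by have [_ pZ] := sp; rewrite -scaleN1r pZ normrN1 mul1r. Qed.

Lemma seminorm_ge0 f : 0 <= p f.
Proof.
have [pD _] := sp; have := pD f (- f).
by rewrite subrr seminorm0// seminormN; lra.
Qed.

Lemma seminorm_distC f g : p (f - g) = p (g - f).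
Proof. by rewrite -seminormN opprB. Qed.

Lemma seminorm_dist_triangle g f h : p (f - h) <= p (f - g) + p (g - h).
Proof. by have [pD _] := sp; rewrite -(subrKA g) pD. Qed.

Lemma seminorm_scale_ge0 (c : R) f : 0 <= c -> p (c *: f) = c * p f.
Proof. by have [_ pZ] := sp => c0; rewrite pZ ger0_norm. Qed.

Lemma seminorm_le_triangle f g : p f <= p (f - g) + p g.
Proof. by have [pD _] := sp; rewrite -{1}(subrK g f) pD. Qed.

Lemma seminorm_sum (I : Type) (r : seq I) (P : pred I) (F : I -> V) :
  p (\sum_(i <- r | P i) F i) <= \sum_(i <- r | P i) p (F i).
Proof.
have [pD _] := sp.
elim/big_rec2 : _ => [|i x y _ yx]; first by rewrite seminorm0.
by rewrite (le_trans (pD _ _))// lerD2l.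
Qed.

End seminorm_theory.

Lemma normr_seminorm (R : realType) (V : normedModType R) : seminorm (@Num.norm _ V).
Proof. by split => [f g|c f]; [exact: ler_normD|exact: normrZ]. Qed.

Section tight_seminorms.
Context {X : topologicalType} {R : realType}.
Implicit Types (f g : Cb X R) (p q : Cb X R -> R).

(** This intrinsic form of strict continuity is easier to check than a bound by a
    family of weighted suprema; in particular it passes to suprema of the form
    [sup_(s <= t) p (S s f)]. *)
Definition tight p := [/\ seminorm p, exists C, forall f, p f <= C * supn f &
  forall e, 0 < e -> exists2 K, compact K &
    forall g, (forall x, K x -> g x = 0) -> p g <= e * supn g].

Lemma tight_bound p : tight p -> exists2 C, 0 < C & forall f, p f <= C * supn f.
Proof.
move=> [_ [C pC] _]; exists (`|C| + 1) => [|f]; first by rewrite ltr_wpDl.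
by rewrite (le_trans (pC f))// ler_wpM2r ?sup_on_ge0// ler_wpDr// ler_norm.
Qed.

Lemma strict_seminorm_has_ubound (K : nat -> set X) (a : nat -> R) f :
  (forall n, 0 <= a n) -> a n @[n --> \oo] --> 0 ->
  has_ubound (range (fun n => a n * sup_on (K n) f)).
Proof.
move=> a0 acv.
have [A aA] : exists A, forall n, `|a n| <= A.
  by apply/Defs.bounded_funP/cvg_seq_bounded/cvg_ex; exists 0.
exists (A * supn f) => _ [n _ <-].
rewrite ler_pM ?sup_on_ge0//; first by rewrite (le_trans _ (aA n))// ler_norm.
by apply: sup_on_le => [|x _]; [exact: sup_on_ge0|exact: ler_supn].
Qed.

Lemma strict_seminorm_ub (K : nat -> set X) (a : nat -> R) f n :
  (forall n, 0 <= a n) -> a n @[n --> \oo] --> 0 ->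
  a n * sup_on (K n) f <= strict_seminorm K a f.
Proof.
by move=> a0 acv; apply: ub_le_sup; [exact: strict_seminorm_has_ubound|exists n].
Qed.

Lemma strict_seminorm_le (K : nat -> set X) (a : nat -> R) f M :
  (forall n, a n * sup_on (K n) f <= M) -> strict_seminorm K a f <= M.
Proof.
move=> fM; apply: ge_sup; first by eexists; exists 0%N.
by move=> _ [n _ <-].
Qed.

Lemma finite_compact_union (K : nat -> set X) N : (forall n, compact (K n)) ->
  exists2 L, compact L & forall n, (n < N)%N -> K n `<=` L.
Proof.
move=> cK; elim: N => [|N [L cL KL]]; first by exists set0; [exact: compact0|].
exists (L `|` K N); first exact: compactU.
move=> n; rewrite ltnS leq_eqVlt => /orP[/eqP ->|/KL nL] x Kx; first by right.
by left; exact: nL.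
Qed.

Lemma strict_tight p : strict_seminorms p -> tight p.
Proof.
move=> sp; split; first exact: strict_seminormsP.
  move: sp => [K [a [cK a0 acv ->]]].
  have [A aA] : exists A, forall n, `|a n| <= A.
    by apply/Defs.bounded_funP/cvg_seq_bounded/cvg_ex; exists 0.
  exists A => f; apply: strict_seminorm_le => n.
  rewrite ler_pM ?sup_on_ge0//; first by rewrite (le_trans _ (aA n))// ler_norm.
  by apply: sup_on_le => [|x _]; [exact: sup_on_ge0|exact: ler_supn].
move: sp => [K [a [cK a0 acv ->]]] e e0.
have /cvgrPdist_le/(_ _ e0)[N _ Ne] := acv.
have [L cL KL] := finite_compact_union N cK; exists L => // g gL.
apply: strict_seminorm_le => n; have [nN|Nn] := ltnP n N.
  have -> : sup_on (K n) g = 0.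
    apply/eqP; rewrite eq_le sup_on_ge0 andbT; apply: sup_on_le => // x Kx.
    by rewrite gL ?normr0//; exact: (KL n).
  by rewrite mulr0 mulr_ge0 ?sup_on_ge0// ltW.
rewrite ler_pM ?sup_on_ge0//.
  by have := Ne n Nn; rewrite /= sub0r normrN; apply: le_trans; exact: ler_norm.
by apply: sup_on_le => [|x _]; [exact: sup_on_ge0|exact: ler_supn].
Qed.

Lemma sup_on_tight K : compact K -> tight (sup_on K).
Proof.
move=> cK; split; first exact: sup_on_seminorm.
  exists 1 => f; rewrite mul1r.
  by apply: sup_on_le => [|x _]; [exact: sup_on_ge0|exact: ler_supn].
move=> e e0; exists K => // g gK.
apply: sup_on_le => [|x /gK ->]; first by rewrite mulr_ge0 ?sup_on_ge0// ltW.
by rewrite normr0 mulr_ge0 ?sup_on_ge0// ltW.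
Qed.

Lemma eval_tight x : tight (fun f => `|f x|).
Proof.
split.
- by split => [f g|c f] /=; [exact: ler_normD|rewrite normrM].
- by exists 1 => f; rewrite mul1r ler_supn.
- move=> e e0; exists [set x]; first exact: compact_set1.
  by move=> g /(_ x erefl) ->; rewrite normr0 mulr_ge0 ?sup_on_ge0// ltW.
Qed.

Lemma tight0 : tight (fun=> 0).
Proof.
split; first by split => *; rewrite ?addr0 ?mulr0.
  by exists 0 => f; rewrite mul0r.
move=> e e0; exists set0; first exact: compact0.
by move=> *; rewrite mulr_ge0 ?sup_on_ge0// ltW.
Qed.

Lemma tightD p q : tight p -> tight q -> tight (fun f => p f + q f).
Proof.
move=> [[pD pZ] [C pC] pK] [[qD qZ] [D qD'] qK]; split.
- split => [f g|c f]; last by rewrite pZ qZ mulrDr.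
  by rewrite addrACA lerD.
- by exists (C + D) => f; rewrite mulrDl lerD.
- move=> e e0; have [|K cK pK'] := pK (e / 2); first by rewrite divr_gt0.
  have [|L cL qL'] := qK (e / 2); first by rewrite divr_gt0.
  exists (K `|` L) => [|g gKL]; first exact: compactU.
  by rewrite (splitr e) mulrDl lerD ?pK' ?qL'// => x ?; apply: gKL; [left|right].
Qed.

Lemma tightZ (c : R) p : 0 <= c -> tight p -> tight (fun f => c * p f).
Proof.
move=> c0 [[pD pZ] [C pC] pK]; split.
- split => [f g|d f]; first by rewrite -mulrDr ler_wpM2l.
  by rewrite pZ mulrCA.
- by exists (c * C) => f; rewrite -mulrA ler_wpM2l.
- move=> e e0; have c1 : 0 < c + 1 by rewrite ltr_wpDl.
  have [|K cK pK'] := pK (e / (c + 1)); first by rewrite divr_gt0.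
  exists K => // g /pK' pg; apply: (le_trans (ler_wpM2l c0 pg)).
  rewrite mulrA ler_wpM2r ?sup_on_ge0//.
  by rewrite mulrA ler_pdivrMr// mulrC ler_wpM2l ?lerDl// ltW.
Qed.

Lemma tight_sum n (p : 'I_n -> Cb X R -> R) : (forall i, tight (p i)) ->
  tight (fun f => \sum_(i < n) p i f).
Proof.
elim: n p => [|n IH] p pt.
  by rewrite (_ : (fun f => _) = fun=> 0); [exact: tight0|apply/funext => f; rewrite big_ord0].
rewrite (_ : (fun f => _) = fun f => \sum_(i < n) p (widen_ord (leqnSn n) i) f + p ord_max f).
  by apply: tightD => //; exact: IH.
by apply/funext => f; rewrite big_ord_recr.
Qed.

Context (chi : nat -> C0 X R) (cchi : cutoffs chi).

Lemma mulC0_cutoff_le f n x : `|mulC0 f (chi n) x| <= `|f x|.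
Proof.
have [chi01 _ _ _] := cchi; have /andP[c0 c1] := chi01 n x.
by rewrite mulC0E normrM ler_piMr// ger0_norm.
Qed.

Lemma cutoff_residual_le f n : supn (f - mulC0 f (chi n) : Cb X R) <= supn f.
Proof.
apply: supn_le => [|x]; first exact: sup_on_ge0.
rewrite (le_trans _ (ler_supn f x))//=.
have [chi01 _ _ _] := cchi; have /andP[c0 c1] := chi01 n x.
rewrite [X in `|X|](_ : _ = f x * (1 - chi n x)); last by rewrite mulrBr mulr1 -mulC0E.
by rewrite normrM ler_piMr// ger0_norm ?subr_ge0// lerBlDr lerDl.
Qed.

(** [f (1 - chi n)] vanishes on a given compact set for large [n]. *)
Lemma cutoff_cvg p f e : tight p -> 0 < e ->
  exists N, forall n, (N <= n)%N -> p (f - mulC0 f (chi n)) <= e.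
Proof.
move=> [sp _ pK] e0; have f1 : 0 < supn f + 1 by rewrite ltr_wpDl// sup_on_ge0.
have [|K cK pK'] := pK (e / (supn f + 1)); first by rewrite divr_gt0.
have [_ _ _ /(_ _ cK)[N chiK]] := cchi; exists N => n Nn.
apply: le_trans (pK' _ _) _ => [x Kx|].
  rewrite [LHS](_ : _ = f x - mulC0 f (chi n) x)// mulC0E chiK// mulr1.
  exact: subrr.
rewrite mulrAC ler_pdivrMr// ler_wpM2l ?(ltW e0)//.
by rewrite (le_trans (cutoff_residual_le _ _))// lerDl.
Qed.

End tight_seminorms.

Section strict_topology.
Context {X : topologicalType} {R : realType}.
Implicit Types (f g : Cb X R) (p q : Cb X R -> R).

(** Write [f] as the sum of [f chi_(n_0)] and of the pieces
    [f (chi_(n_(j + 1)) - chi_(n_j))], with [n_j] so large that [p] is bounded by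
    [4 ^- j] times the norm on each piece. If [L_j] is a compact support of
    [chi_(n_j)], then
    [p f <= C sup_(L_0) |f| + sum_j 4 ^- j sup_(L_(j + 1)) |f|], which is at most
    [(C + 4) sup_j 2 ^- j sup_(L_j) |f|]. *)
Lemma tight_dominated (chi : nat -> C0 X R) p : cutoffs chi -> tight p ->
  exists q C, [/\ strict_seminorms q, 0 < C & forall f, p f <= C * q f].
Proof.
move=> cchi tp; have [chi01 chile chisupp chiK] := cchi.
have [C C0 pC] := tight_bound tp.
have [sp _ pK] := tp.
have /choice[thr thrP] j : exists N, forall g,
    (forall x, chi N x = 1 -> g x = 0) -> p g <= (2^-1 ^+ j) * (2^-1 ^+ j) * supn g.
  have [|K cK pK'] := pK (2^-1 ^+ j * 2^-1 ^+ j); first by rewrite mulr_gt0// exprn_gt0.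
  have [N NK] := chiK _ cK; exists N => g gN; apply: pK' => x Kx.
  by rewrite gN// (NK N).
(* The partial sums of [thr] are nondecreasing and dominate it; the summand [j]
   makes [n] unbounded. *)
pose n j := (j + \sum_(i < j.+1) thr i)%N.
have thrn j : (thr j <= n j)%N by rewrite /n big_ord_recr/= addnA leq_addl.
have nS j : (n j <= n j.+1)%N by rewrite /n [X in (_ <= _ + X)%N]big_ord_recr/= leq_add ?leq_addr.
have /choice[L LP] j : exists L, compact L /\ forall x, ~ L x -> chi (n j) x = 0.
  by have [L cL L0] := chisupp (n j); exists L.
pose a j : R := 2^-1 ^+ j.
have a0 j : 0 <= a j by rewrite exprn_ge0.
have acv : a j @[j --> \oo] --> 0.
  by apply: cvg_expr; rewrite ger0_norm// invf_lt1// ltr1n.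
have sq : strict_seminorms (strict_seminorm L a).
  by exists L, a; split => // j; have [] := LP j.
pose q : Cb X R -> R := strict_seminorm L a.
have Lq f j : sup_on (L j) f <= 2 ^+ j * q f.
  have := strict_seminorm_ub L f j a0 acv; rewrite -/(q f) /a exprVn.
  by rewrite ler_pdivrMl// exprn_gt0.
have q0 f : 0 <= q f by apply: seminorm_ge0; exact: strict_seminormsP.
exists q, (C + 4); split => //; first by rewrite addr_gt0.
move=> f.
have pN N : p (mulC0 f (chi (n N))) <= (C + 4 - 4 * 2^-1 ^+ N) * q f.
  elim: N => [|N IH].
    rewrite expr0 mulr1 addrK (le_trans (pC _))// ler_wpM2l ?(ltW C0)//.
    have := Lq f 0%N; rewrite expr0 mul1r; apply: le_trans.
    apply: supn_le => [|x]; first exact: sup_on_ge0.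
    have [Lx|nLx] := pselect (L 0%N x).
      by rewrite (le_trans (mulC0_cutoff_le cchi f _ x))// sup_on_ub.
    rewrite mulC0E (LP 0%N).2// mulr0 normr0; exact: sup_on_ge0.
  rewrite (le_trans (seminorm_le_triangle sp _ (mulC0 f (chi (n N)))))//.
  set g : Cb X R := _ - _.
  have gE x : g x = f x * (chi (n N.+1) x - chi (n N) x).
    by rewrite mulrBr -!mulC0E.
  have chiB x : 0 <= chi (n N.+1) x - chi (n N) x <= 1.
    have /andP[? ?] := chi01 (n N) x; have /andP[? ?] := chi01 (n N.+1) x.
    by have := chile _ _ (nS N) x => ?; apply/andP; split; lra.
  have pg : p g <= (2^-1 ^+ N) * (2^-1 ^+ N) * supn g.
    apply: thrP => x chi1.
    have one m : (thr N <= m)%N -> chi m x = 1.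
      move=> thrm; apply/eqP; rewrite eq_le; have /andP[_ ->] := chi01 m x.
      by rewrite -chi1 chile.
    by rewrite gE !one ?subrr ?mulr0// (leq_trans (thrn N)).
  have gL : supn g <= 2 ^+ N.+1 * q f.
    rewrite (le_trans _ (Lq f N.+1))//; apply: supn_le => [|x]; first exact: sup_on_ge0.
    have /andP[c0 c1] := chiB x; have [Lx|nLx] := pselect (L N.+1 x).
      rewrite gE normrM (le_trans _ (sup_on_ub f Lx))// ler_piMr//.
      by rewrite ger0_norm.
    have cS := (LP N.+1).2 _ nLx.
    have -> : g x = 0.
      rewrite gE cS; have /andP[+ _] := chi01 (n N) x.
      by move: c0; rewrite cS => ? ?; have -> : chi (n N) x = 0; [lra|rewrite subrr mulr0].
    by rewrite normr0 sup_on_ge0.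
  have e0 : 0 <= (2^-1 : R) ^+ N by rewrite exprn_ge0.
  have {}pg : p g <= 2 * 2^-1 ^+ N * q f.
    apply: (le_trans pg); apply: (le_trans (ler_wpM2l (mulr_ge0 e0 e0) gL)).
    rewrite exprS exprVn; set z := 2 ^+ N.
    have z0 : z != 0 by rewrite expf_neq0.
    by rewrite le_eqVlt; apply/orP; left; apply/eqP; field.
  rewrite exprS; move: pg IH; set u := 2^-1 ^+ N; lra.
apply/ler_addgt0Pr => e e0.
have [N pfN] := cutoff_cvg cchi f tp e0.
rewrite (le_trans (seminorm_le_triangle sp _ (mulC0 f (chi (n N)))))// addrC lerD//.
  rewrite (le_trans (pN N))// ler_wpM2r// lerBlDr lerDl.
  by rewrite mulr_ge0// exprn_ge0.
by apply: pfN; rewrite /n leq_addr.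
Qed.

Lemma strict_nbhs_tight f U : nbhs f U ->
  exists2 p, tight p & forall g, p (g - f) < 1 -> U g.
Proof.
move=> [n [p [e [pS e0 pU]]]].
exists (fun g => e^-1 * \sum_(i < n) p i g).
  apply: tightZ; first by rewrite invr_ge0 ltW.
  by apply: tight_sum => i; apply: strict_tight; exact: pS.
move=> g; rewrite mulrC ltr_pdivrMr// mul1r => pg; apply: pU => i /=.
apply: le_lt_trans pg; rewrite (bigD1 i)//= lerDl sumr_ge0// => j _.
by apply: seminorm_ge0; apply: strict_seminormsP; exact: pS.
Qed.

(** A continuous seminorm is less than [1] where some tight seminorm [q] is, hence
    is at most [q] by homogeneity. *)
Lemma continuous_tight p : seminorm p -> continuous p -> tight p.
Proof.
move=> sp cp.
have /strict_nbhs_tight[q tq qp] : nbhs (0 : Cb X R) [set f | p f < 1].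
  have /(@cvgrPdist_lt _ _ _ _ (nbhs_filter (0 : Cb X R)))/(_ _ ltr01) := cp 0.
  apply: (@filterS _ _ (nbhs_filter _)) => f /=.
  by rewrite seminorm0// sub0r normrN; apply: le_lt_trans; exact: ler_norm.
have pq f : p f <= q f.
  have sq := let: And3 sq _ _ := tq in sq.
  apply/ler_addgt0Pr => e e0.
  have c0 : 0 < q f + e by rewrite ltr_wpDl// seminorm_ge0.
  have : p ((q f + e)^-1 *: f) < 1.
    apply: qp; rewrite subr0 seminorm_scale_ge0// ?invr_ge0 ?(ltW c0)//.
    by rewrite mulrC ltr_pdivrMr// mul1r ltrDl.
  rewrite seminorm_scale_ge0// ?invr_ge0 ?(ltW c0)//.
  by rewrite mulrC ltr_pdivrMr// mul1r => /ltW.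
have [_ [C qC] qK] := tq.
split => //; first by exists C => f; exact: le_trans (qC f).
move=> e /qK[K cK qK']; exists K => // g /qK'; exact: le_trans.
Qed.

Context (chi : nat -> C0 X R) (cchi : cutoffs chi).

Lemma tight_nbhs p f e : tight p -> 0 < e -> nbhs f [set g | p (g - f) < e].
Proof.
move=> tp e0; have [q [C [sq C0 pq]]] := tight_dominated cchi tp.
exists 1%N, (fun=> q), (e / C); split => //; first by rewrite divr_gt0.
move=> g /(_ ord0); rewrite ltr_pdivlMr// mulrC; exact: le_lt_trans.
Qed.

Lemma tight_continuous p : tight p -> continuous p.
Proof.
move=> tp f; apply/(@cvgrPdist_lt _ _ _ _ (nbhs_filter f)) => e e0; have := tight_nbhs f tp e0.
have sp := let: And3 sp _ _ := tp in sp.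
apply: (@filterS _ _ (nbhs_filter _)) => g /=.
have := seminorm_le_triangle sp f g; have := seminorm_le_triangle sp g f.
by rewrite (seminorm_distC sp f g) ltr_norml => ? ? ?; apply/andP; split; lra.
Qed.

Lemma cvg_strictP (T : Type) (F : set_system T) (h : T -> Cb X R) f : Filter F ->
  h @ F --> f <-> forall p, tight p -> forall e, 0 < e -> \forall t \near F, p (h t - f) < e.
Proof.
move=> FF; split => [hf p tp e e0|hf U /strict_nbhs_tight[p tp pU]].
  exact: hf _ (tight_nbhs f tp e0).
by have := hf p tp 1 ltr01; apply: filterS => t; exact: pU.
Qed.

End strict_topology.

(** * Semigroups of linear maps *)

Section linear_maps.
Context {R : realType} {V : lmodType R} (f : V -> V).
Context (lf : linear f).

Lemma linear_mapD u v : f (u + v) = f u + f v.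
Proof. by have := lf 1 u v; rewrite !scale1r. Qed.

Lemma linear_map0 : f 0 = 0.
Proof. by have := linear_mapD 0 0; rewrite addr0 -{1}[f 0]addr0 => /addrI. Qed.

Lemma linear_mapZ a u : f (a *: u) = a *: f u.
Proof. by have := lf a u 0; rewrite !addr0 linear_map0 addr0. Qed.

Lemma linear_mapN u : f (- u) = - f u.
Proof. by rewrite -scaleN1r linear_mapZ scaleN1r. Qed.

Lemma linear_mapB u v : f (u - v) = f u - f v.
Proof. by rewrite linear_mapD linear_mapN. Qed.

End linear_maps.

Section semigroup_theory.
Context {R : realType} {V : lmodType R} (S : R -> V -> V).
Context (sgS : semigroup S).

Lemma semigroup_linear t : 0 <= t -> linear (S t).
Proof. by case: sgS => + _ _; exact. Qed.

Lemma semigroup0 f : S 0 f = f.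
Proof. by case: sgS => _ -> _. Qed.

Lemma semigroupD s t f : 0 <= s -> 0 <= t -> S (t + s) f = S t (S s f).
Proof. by case: sgS => _ _ /(_ s t) + s0 t0 => /(_ s0 t0) <-. Qed.

(** This plays the part of [S t f - f = \int_0^t S s g ds]. Telescope over the
    [n + 1] steps of length [t / (n + 1)], each of which contributes the image of
    a difference quotient of [f]. *)
Lemma semigroup_mean_value (p q : V -> R) f g g' t B : seminorm p -> 0 < t ->
  (forall v s, 0 <= s <= t -> p (S s v) <= q v) ->
  (forall e, 0 < e -> exists n : nat,
     q ((t / n.+1%:R)^-1 *: (S (t / n.+1%:R) f - f) - g) <= e) ->
  (forall s, 0 <= s <= t -> p (S s g - g') <= B) ->
  p (S t f - f - t *: g') <= t * B.
Proof.
move=> sp t0 pq fg gg'; have [pD pZ] := sp.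
apply/ler_addgt0Pr => e e0.
have [|n qn] := fg (e / t); first by rewrite divr_gt0.
pose h : R := t / n.+1%:R; pose r := h^-1 *: (S h f - f) - g.
have h0 : 0 < h by rewrite divr_gt0.
have tE : t = n.+1%:R * h by rewrite /h mulrC divfK.
have -> : S t f - f - t *: g' =
    \sum_(k < n.+1) (S (k.+1%:R * h) f - S (k%:R * h) f - h *: g').
  rewrite big_split/= sumr_const card_ord; congr (_ + _); last first.
    by rewrite mulNrn scalerMnl {1}tE mulr_natl.
  rewrite -(big_mkord xpredT (fun k => S (k.+1%:R * h) f - S (k%:R * h) f)).
  by rewrite telescope_sumr// mul0r semigroup0 -tE.
rewrite (le_trans (seminorm_sum sp _ _ _))//.
have -> : t * B + e = \sum_(k < n.+1) (h * (B + e / t)).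
  rewrite sumr_const card_ord -mulr_natl mulrA -tE mulrDr.
  by rewrite [t * (e / t)]mulrC divfK// gt_eqF.
apply: ler_sum => k _.
have kh : 0 <= k%:R * h <= t.
  rewrite mulr_ge0 ?(ltW h0)//= tE ler_wpM2r ?(ltW h0)// ler_nat.
  exact: ltnW.
have [kh0 _] := andP kh.
have Shf : S h f - f = h *: (r + g).
  by rewrite /r subrK scalerA mulfV ?gt_eqF// scale1r.
rewrite -natr1 mulrDl mul1r (semigroupD _ (ltW h0))//.
rewrite -(linear_mapB (semigroup_linear kh0)) Shf linear_mapZ//; last exact: semigroup_linear.
rewrite -scalerBr seminorm_scale_ge0 ?(ltW h0)// ler_wpM2l ?(ltW h0)//.
rewrite linear_mapD; last exact: semigroup_linear.
rewrite -addrA (le_trans (pD _ _))// [B + _]addrC lerD//; last exact: gg'.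
by rewrite (le_trans (pq _ _ kh)).
Qed.

(** The average of the orbit over the [2 ^ N] dyadic multiples of [d], computed
    by repeated halving: it is the product of the operators
    [(id + S (2 ^ i d)) / 2] for [i < N]. *)
Fixpoint dyadic_average (N : nat) (d : R) (f : V) : V :=
  if N is N'.+1 then
    2^-1 *: (dyadic_average N' d f + S (2 ^+ N' * d) (dyadic_average N' d f))
  else f.

Local Notation avg := dyadic_average.

Lemma dyadic_average_le N d f g p B u : seminorm p -> 0 <= d -> 0 <= u ->
  (forall s, u <= s <= u + 2 ^+ N * d -> p (S s f - g) <= B) ->
  p (S u (avg N d f) - g) <= B.
Proof.
move=> sp d0; have [pD _] := sp; elim: N u => [|N IH] u u0 H /=.
  by apply: H; rewrite lexx expr0 mul1r lerDl.
have Nd : 0 <= 2 ^+ N * d by rewrite mulr_ge0// exprn_ge0.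
have lS := semigroup_linear u0.
rewrite linear_mapZ// linear_mapD// -semigroupD//.
set x := S u _; set y := S _ (avg N d f).
have -> : 2^-1 *: (x + y) - g = 2^-1 *: (x - g) + 2^-1 *: (y - g).
  have gE : g = 2^-1 *: (g + g) by rewrite -mulr2n -[g *+ 2]scaler_nat scalerA mulVf// scale1r.
  by rewrite {1}gE -scalerBr -scalerDr opprD addrACA.
rewrite (le_trans (pD _ _))// !(seminorm_scale_ge0 sp)//.
have xg : p (x - g) <= B.
  by apply: IH => // s /andP[us su]; apply: H; rewrite us exprS/=; move: su Nd; lra.
have yg : p (y - g) <= B.
  apply: IH => [|s /andP[us su]]; first exact: addr_ge0.
  by apply: H; rewrite exprS; move: us su Nd; move: (2 ^+ N) => z *; apply/andP; split; lra.
by move: xg yg; lra.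
Qed.

Lemma dyadic_averageD a b d f : avg (a + b) d f = avg a (2 ^+ b * d) (avg b d f).
Proof. by elim: a => [//|a IH]; rewrite addSn /= IH mulrA -exprD. Qed.

(** [S (2 ^ N d) - id] is [S d - id] times the product of the [id + S (2 ^ i d)]
    for [i < N]. *)
Lemma dyadic_average_telescope N d f : 0 <= d ->
  2 ^+ N *: (S d (avg N d f) - avg N d f) = S (2 ^+ N * d) f - f.
Proof.
move=> d0; elim: N => [|N IH] /=; first by rewrite expr0 mul1r scale1r.
have Nd : 0 <= 2 ^+ N * d by rewrite mulr_ge0// exprn_ge0.
have lS := semigroup_linear d0; have lN := semigroup_linear Nd.
rewrite (linear_mapZ lS) (linear_mapD lS) -scalerBr scalerA exprS.
rewrite -mulrA [2 ^+ N * _]mulrC mulrA mulfV// mul1r.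
rewrite -semigroupD// [d + _]addrC semigroupD// opprD addrACA -(linear_mapB lN).
rewrite scalerDr -(linear_mapZ lN) IH (linear_mapB lN) -semigroupD//.
have -> : 2 * 2 ^+ N * d = 2 ^+ N * d + 2 ^+ N * d by lra.
by rewrite addrC addrA subrK.
Qed.

End semigroup_theory.

Lemma near_right0P (R : realType) (P : R -> Prop) :
  (\forall t \near 0^'+, P t) <-> exists2 d, 0 < d & forall t, 0 < t < d -> P t.
Proof.
split=> [H|[d d0 dP]].
  have : nbhs (0 : R) [set t | 0 < t -> P t] by exact: H.
  move=> /nbhs_ballP[d /= d0 dP].
  exists d => // t /andP[t0 td]; apply: dP => //.
  by rewrite -ball_normE /= sub0r normrN gtr0_norm.
near=> t; apply: dP; apply/andP; split.
  by near: t; exact: nbhs_right_gt.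
by near: t; exact: nbhs_right_lt.
Unshelve. all: by end_near. Qed.

(** * Means of orbits in [C0] *)

Section dyadic_average_limit.
Context {X : topologicalType} {R : realType} (T : R -> C0 X R -> C0 X R).
Context (sgT : semigroup T).
Context (T_bounded : forall t, 0 <= t ->
  exists2 M, 0 < M & forall h s, 0 <= s <= t -> `|T s h| <= M * `|h|).
Context (T_cont0 : forall h e, 0 < e ->
  exists2 d, 0 < d & forall s, 0 <= s < d -> `|T s h - h| <= e).
Implicit Types h k : C0 X R.
Local Notation avg := (dyadic_average T).

Lemma dyadic_averageB N d h k : 0 <= d -> avg N d (h - k) = avg N d h - avg N d k.
Proof.
move=> d0; elim: N => [//|N IH] /=.
have Nd : 0 <= 2 ^+ N * d by rewrite mulr_ge0// exprn_ge0.
rewrite IH (linear_mapB (semigroup_linear sgT Nd)) -scalerBr; congr (_ *: _).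
by rewrite addrACA -opprD.
Qed.

Lemma dyadic_average_sub_le N d h B : 0 <= d ->
  (forall s, 0 <= s <= 2 ^+ N * d -> `|T s h - h| <= B) -> `|avg N d h - h| <= B.
Proof.
move=> d0 H; rewrite -[avg N d h](semigroup0 sgT).
apply: (dyadic_average_le sgT (@normr_seminorm _ _)) => // s; rewrite add0r; exact: H.
Qed.

(** If the difference quotients of [k] converge to [g] along [r / 2 ^ m], then
    by the mean value inequality [T t k - k] is close to [t g] at all dyadic
    multiples of [r], hence at all small [t]. *)
Lemma generator_dyadic r k g : 0 < r ->
  (forall e, 0 < e -> exists m0, forall m, (m0 <= m)%N ->
     `|(r / 2 ^+ m)^-1 *: (T (r / 2 ^+ m) k - k) - g| <= e) ->
  generator T (k, g).
Proof.
move=> r0 kg; apply/cvgrPdist_le => e e0 /=; apply/near_right0P.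
have d0 m : 0 < r / 2 ^+ m by rewrite divr_gt0// exprn_gt0.
have [d dp dg] := T_cont0 g e0; exists d => // t /andP[t0 td].
suff H : `|T t k - k - t *: g| <= t * e.
  have -> : g - t^-1 *: (T t k - k) = - (t^-1 *: (T t k - k - t *: g)).
    by rewrite [in RHS]scalerBr scalerA mulVf ?gt_eqF// scale1r opprB.
  by rewrite normrN normrZ gtr0_norm ?invr_gt0// mulrC ler_pdivrMr// mulrC.
have [M M0 TM] := T_bounded (ltW t0).
apply/ler_addgt0Pr => e' e'0.
have [|d' d'0 dk] := T_cont0 k (e := e' / 2 / M); first by rewrite !divr_gt0.
have [|m mP] := @half_expn_small R r (Num.min (Num.min t d') (e' / 2 / (`|g| + 1))).
  by rewrite !lt_min t0 d'0/= !divr_gt0// ltr_wpDl.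
pose j := Num.truncn (t / (r / 2 ^+ m)); pose u : R := j%:R * (r / 2 ^+ m).
have := mP m (leqnn m); rewrite !lt_min => /andP[/andP[mt md'] mg].
have /andP[ut tu] : u <= t < u + r / 2 ^+ m.
  have /truncn_itv/andP[a b] : 0 <= t / (r / 2 ^+ m) by rewrite ltW// divr_gt0.
  rewrite /u -[X in _ && (_ < _ + X)]mul1r -mulrDl natr1.
  by rewrite -ler_pdivlMr// a -ltr_pdivrMr.
have u0 : 0 < u.
  rewrite /u mulr_gt0// ltr0n lt0n; apply/negP => /eqP j0.
  by move: tu; rewrite /u j0 mul0r add0r ltNge (ltW mt).
have j0 : (0 < j)%N by move: u0; rewrite /u pmulr_lgt0// ltr0n.
have ug : `|T u k - k - u *: g| <= u * e.
  apply: (semigroup_mean_value sgT (q := fun h => M * `|h|) (g := g)) => //.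
  - exact: normr_seminorm.
  - by move=> h s /andP[s0 su]; apply: TM; rewrite s0 (le_trans su).
  - move=> e1 e10; have [|m0 m0P] := kg (e1 / M); first by rewrite divr_gt0.
    exists (j * 2 ^ m0).-1; rewrite prednK ?muln_gt0 ?j0 ?expn_gt0//.
    have -> : u / (j * 2 ^ m0)%:R = r / 2 ^+ (m + m0).
      have p2 n : (2 : R) ^+ n != 0 by rewrite expf_neq0.
      have jn0 : j%:R != 0 :> R by rewrite pnatr_eq0 -lt0n.
      by rewrite /u natrM natrX exprD; field; rewrite !p2.
    by rewrite mulrC -ler_pdivlMr// m0P// leq_addl.
  - move=> s /andP[s0 su]; apply: dg; rewrite s0 (le_lt_trans su)//.
    exact: le_lt_trans td.
have tk : `|T t k - T u k| <= e' / 2.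
  have -> : T t k - T u k = T u (T (t - u) k - k).
    rewrite (linear_mapB (semigroup_linear sgT (ltW u0))).
    by rewrite -(semigroupD sgT)// ?subr_ge0// ?(ltW u0)// [u + _]addrC subrK.
  rewrite (le_trans (TM _ _ _)) ?(ltW u0)// mulrC -ler_pdivlMr//.
  by apply: dk; rewrite subr_ge0 ut ltrBlDl (lt_trans tu)// ltrD2l.
have gk : `|u *: g - t *: g| <= e' / 2.
  rewrite -scalerBl normrZ distrC ger0_norm ?subr_ge0//.
  have g1 : 0 < `|g| + 1 by rewrite ltr_wpDl.
  rewrite (@le_trans _ _ (e' / 2 / (`|g| + 1) * `|g|))//.
    by rewrite ler_wpM2r// lerBlDl ltW// (lt_trans tu)// ltrD2l.
  by rewrite mulrAC ler_pdivrMr// ler_wpM2l ?divr_ge0 ?(ltW e'0)// lerDl.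
have -> : T t k - k - t *: g = (T t k - T u k) + (T u k - k - u *: g) + (u *: g - t *: g).
  rewrite -!addrA; congr (_ + _); rewrite addrA addNr add0r; congr (_ + _).
  by rewrite addrA addNr add0r.
have ue : u * e <= t * e by rewrite ler_wpM2r// ltW.
rewrite (le_trans (ler_normD _ _))// (le_trans (lerD (ler_normD _ _) (lexx _)))//.
by move: tk gk ug ue; move: `|_| `|_| `|_| (u * e) (t * e) => ? ? ? ? ? ; lra.
Qed.

(** The mean [(1 / r) \int_0^r T s h ds] of the orbit, obtained as a limit of
    dyadic averages, is in the domain of the generator. *)
Lemma generator_average r h : 0 < r -> exists k,
  generator T (k, r^-1 *: (T r h - h)) /\
  forall e, 0 < e -> exists N, `|avg N (r / 2 ^+ N) h - k| <= e.
Proof.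
move=> r0; have d0 m : 0 < r / 2 ^+ m by rewrite divr_gt0// exprn_gt0.
have d0' m : 0 <= r / 2 ^+ m by exact: ltW.
have [M M0 TM] := T_bounded (ltW r0).
have small e : 0 < e -> exists m0, forall m, (m0 <= m)%N ->
    forall b, `|avg b (r / 2 ^+ (m + b)) h - h| <= e.
  move=> e0; have [d dp dh] := T_cont0 h e0.
  have [m0 m0P] := half_expn_small r dp; exists m0 => m m0m b.
  apply: dyadic_average_sub_le => //= s; rewrite half_split => /andP[s0 sm].
  by apply: dh; rewrite s0 (le_lt_trans sm)// m0P.
pose u N := avg N (r / 2 ^+ N) h.
have uE m b : u (m + b)%N = avg m (r / 2 ^+ m) (avg b (r / 2 ^+ (m + b)) h).
  by rewrite /u dyadic_averageD half_split.
have avgM m v : `|avg m (r / 2 ^+ m) v| <= M * `|v|.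
  rewrite -[avg m _ _](semigroup0 sgT) -[T 0 _]subr0.
  apply: (dyadic_average_le sgT (@normr_seminorm _ _)) => //= s.
  by rewrite add0r exprK_half subr0; exact: TM.
have [|k kP] := @C0_complete _ _ u.
  move=> e e0; have [|m mP] := small (e / 2 / M); first by rewrite !divr_gt0.
  have um n : (m <= n)%N -> `|u n - u m| <= e / 2.
    move=> /subnKC <-; set b := (n - m)%N; rewrite uE /u -dyadic_averageB//.
    by rewrite (le_trans (avgM _ _))// mulrC -ler_pdivlMr// mP.
  exists m => a b am bm; rewrite -(subrKA (u m)) (le_trans (ler_normD _ _))//.
  by rewrite [`|u m - _|]distrC (splitr e) lerD// um.
exists k; split; last first.
  by move=> e /kP[N kN]; exists N; exact: kN.
apply: (generator_dyadic r0) => e e0.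
have [|m0 m0P] := small (e * r / (2 * (M + 1))).
  by rewrite divr_gt0 ?mulr_gt0// addr_gt0.
exists m0 => m mm0.
have p2 n : (0 : R) < 2 ^+ n by rewrite exprn_gt0.
have {}avgM := avgM. set d := r / 2 ^+ m.
have [|N kN] := kP (e * r / (2 * (M + 1)) / 2 ^+ m).
  by rewrite !divr_gt0 ?mulr_gt0// addr_gt0.
have := kN (m + N)%N (leq_addl _ _); set v := u (m + N)%N => vk.
set h' := avg N (r / 2 ^+ (m + N)) h.
have tel : 2 ^+ m *: (T d v - v) = T r h' - h'.
  by rewrite /v uE /d (dyadic_average_telescope sgT) ?exprK_half.
have dE : d^-1 = r^-1 * 2 ^+ m by rewrite /d invfM invrK mulrC.
have lTd := semigroup_linear sgT (d0' m); rewrite -/d in lTd.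
have lTr := semigroup_linear sgT (ltW r0).
rewrite dE -scalerA -scalerBr normrZ gtr0_norm ?invr_gt0// mulrC ler_pdivrMr//.
have -> : 2 ^+ m *: (T d k - k) - (T r h - h) =
    2 ^+ m *: (T d (k - v) - (k - v)) + (T r (h' - h) - (h' - h)).
  have sub (W : zmodType) (a b c z : W) : a - b - (c - z) = (a - c) - (b - z).
    by rewrite !opprB addrACA [RHS]addrACA [- b - c]addrC.
  rewrite (linear_mapB lTd) (linear_mapB lTr) !(sub _ (T _ _) (T _ _)).
  by rewrite [2 ^+ m *: (_ - (T d v - v))]scalerBr tel addrA subrK.
have Mn w s : 0 <= s <= r -> `|T s w - w| <= (M + 1) * `|w|.
  move=> sr; rewrite (le_trans (ler_normB _ _))// mulrDl mul1r lerD2r.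
  exact: TM.
have M1 : 0 < M + 1 by rewrite addr_gt0.
have dr : 0 <= d <= r.
  by rewrite /d d0'/= ler_pdivrMr// ler_peMr ?(ltW r0)// exprn_ege1// ler1n.
rewrite (le_trans (ler_normD _ _))// (splitr (e * r)) lerD//.
  rewrite normrZ gtr0_norm// (le_trans (ler_wpM2l (ltW (p2 m)) (Mn _ _ dr)))//.
  rewrite distrC in vk; move: vk; rewrite ler_pdivlMr// => /(ler_wpM2l (ltW M1)).
  move=> vk; rewrite mulrCA [_ * `|_|]mulrC; apply: (le_trans vk).
  by rewrite le_eqVlt; apply/orP; left; apply/eqP; field; rewrite gt_eqF.
rewrite (le_trans (Mn _ _ _)) ?lexx ?(ltW r0)//.
have := m0P m mm0 N; rewrite -/h' => /(ler_wpM2l (ltW M1)) /le_trans; apply.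
by rewrite le_eqVlt; apply/orP; left; apply/eqP; field; rewrite gt_eqF.
Qed.

End dyadic_average_limit.

(** * SCLE semigroups *)

Section SCLE_theory.
Context {X : topologicalType} {R : realType}.
Context (chi : nat -> C0 X R) (cchi : cutoffs chi).
Context (S : R -> Cb X R -> Cb X R) (SC : SCLE_semigroup S).
Implicit Types (f g : Cb X R) (p q : Cb X R -> R).

Lemma SCLE_is_semigroup : semigroup S.
Proof. by case: SC. Qed.

Lemma SCLE_equicontinuous t p : 0 <= t -> tight p ->
  exists2 q, tight q & forall f s, 0 <= s <= t -> p (S s f) <= q f.
Proof.
move=> t0 tp; case: SC => _ _ _ /(_ t t0 p).
case=> [||q [sq cq pq]]; first by case: tp.
  exact (tight_continuous cchi tp).
by exists q => //; exact: continuous_tight.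
Qed.

Lemma SCLE_orbit_continuous f t0 p e : 0 <= t0 -> tight p -> 0 < e ->
  exists2 d, 0 < d & forall s, 0 <= s -> `|s - t0| < d -> p (S s f - S t0 f) < e.
Proof.
move=> t00 tp e0; case: SC => _ _ /(_ f)/subspace_continuousP/(_ t0 t00) + _.
move=> /(cvg_strictP cchi)/(_ p tp e e0)/nbhs_ballP[d /= d0 dP].
exists d => // s s0 sd; apply: dP => //.
by rewrite -ball_normE /= distrC.
Qed.

(** Otherwise some values [S s_n f_n x_n] exceed [4 ^ n ||f_n||], and the
    seminorm [sup_n 2 ^- n |f x_n|] contradicts local equicontinuity. *)
Lemma SCLE_norm_bounded t : 0 <= t ->
  exists2 M, 0 < M & forall f s, 0 <= s <= t -> supn (S s f) <= M * supn f.
Proof.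
move=> t0; apply: contrapT => nM.
have /choice[z zP] n : exists z : R * Cb X R * X,
    0 <= z.1.1 <= t /\ 2 ^+ n * 2 ^+ n * supn z.1.2 < `|S z.1.1 z.1.2 z.2|.
  apply: contrapT => nz; apply: nM; exists (2 ^+ n * 2 ^+ n).
    by rewrite mulr_gt0// exprn_gt0.
  move=> f s st; apply: supn_le => [|x].
    by rewrite !mulr_ge0 ?exprn_ge0// sup_on_ge0.
  by rewrite leNgt; apply/negP => H; apply: nz; exists (s, f, x).
pose a n : R := 2^-1 ^+ n.
have a0 n : 0 <= a n by rewrite exprn_ge0.
have acv : a n @[n --> \oo] --> 0.
  by apply: cvg_expr; rewrite ger0_norm// invf_lt1// ltr1n.
pose K n : set X := [set (z n).2].
have ps : strict_seminorms (strict_seminorm K a).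
  by exists K, a; split => // n; exact: compact_set1.
have [q tq pq] := SCLE_equicontinuous t0 (strict_tight ps).
have [C C0 qC] := tight_bound tq.
have C2 n : 2 ^+ n < C.
  have [st zn] := zP n; set f := (z n).1.2 in zn *; set s := (z n).1.1 in st zn.
  have f0 : 0 <= supn f by exact: sup_on_ge0.
  have H : 2 ^+ n * supn f < C * supn f.
    apply: lt_le_trans (qC f); apply: lt_le_trans (pq f s st).
    apply: lt_le_trans (strict_seminorm_ub K (S s f) n a0 acv).
    apply: (@lt_le_trans _ _ (a n * `|S s f (z n).2|)).
      by rewrite /a exprVn ltr_pdivlMl ?exprn_gt0// mulrA.
    by rewrite ler_wpM2l// sup_on_ub.
  have : supn f != 0 by apply: contraTneq H => ->; rewrite !mulr0 ltxx.
  move=> fn0; have fp : 0 < supn f by rewrite lt_neqAle eq_sym fn0.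
  by rewrite ltr_pM2r in H.
have [|m /(_ m (leqnn m))] := @half_expn_small R 1 (C^-1); first by rewrite invr_gt0.
rewrite div1r ltf_pV2 ?posrE ?exprn_gt0//.
by rewrite ltNge (ltW (C2 m)).
Qed.

Lemma generator_strictP f g : generator S (f, g) <->
  forall p, tight p -> forall e, 0 < e ->
    exists2 d, 0 < d & forall t, 0 < t < d -> p (t^-1 *: (S t f - f) - g) < e.
Proof.
split=> [/(cvg_strictP cchi) H p tp e e0|H].
  exact/near_right0P/(H p tp e e0).
by apply/(cvg_strictP cchi) => p tp e e0; apply/near_right0P; exact: H.
Qed.

End SCLE_theory.

Lemma C0_restriction_extends (X : topologicalType) (R : realType)
  (S : R -> Cb X R -> Cb X R) : preserves_C0 S -> extends S (C0_restriction S).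
Proof.
move=> SC0 t t0 f; rewrite /C0_restriction [RHS]insubdK//.
by apply: SC0 => //; case: f.
Qed.

Section invariance_of_C0.
Context {X : topologicalType} {R : realType}.
Context (chi : nat -> C0 X R) (cchi : cutoffs chi).
Context (S : R -> Cb X R -> Cb X R) (T : R -> C0 X R -> C0 X R).
Context (SC : SCLE_semigroup S) (ST : extends S T).

Let sgS := SCLE_is_semigroup SC.

Lemma restriction_semigroup : semigroup T.
Proof.
split.
- move=> t t0 a u v; apply/val_inj => /=; rewrite -(ST t0).
  by rewrite (semigroup_linear sgS t0) !ST.
- apply/funext => f; apply/val_inj; rewrite -[LHS](ST (lexx 0)).
  exact: (semigroup0 sgS).
- move=> s t s0 t0; apply/funext => f; apply/val_inj.
  rewrite -[RHS](ST (addr_ge0 t0 s0)) (semigroupD sgS)//.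
  by rewrite (ST s0) (ST t0).
Qed.

Lemma restriction_norm_bounded t : 0 <= t ->
  exists2 M, 0 < M & forall h s, 0 <= s <= t -> `|T s h| <= M * `|h|.
Proof.
move=> t0; have [M M0 SM] := SCLE_norm_bounded cchi SC t0; exists M => // h s st.
by have := SM h s st; rewrite ST//; have /andP[] := st.
Qed.

End invariance_of_C0.

(** * The generator of the restriction is a core *)

Section core.
Context {X : topologicalType} {R : realType}.
Context (chi : nat -> C0 X R) (cchi : cutoffs chi).
Context (S : R -> Cb X R -> Cb X R) (T : R -> C0 X R -> C0 X R).
Context (SC : SCLE_semigroup S) (TC : strongly_continuous_semigroup T).
Context (ST : extends S T).
Implicit Types (f g : Cb X R) (p q : Cb X R -> R) (h k : C0 X R).

Let sgS := SCLE_is_semigroup SC.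
Let sgT : semigroup T. Proof. by case: TC. Qed.

Lemma scs_continuous0 h e : 0 < e ->
  exists2 d, 0 < d & forall s, 0 <= s < d -> `|T s h - h| <= e.
Proof.
move=> e0; case: TC => _ _ /(_ h)/subspace_continuousP/(_ 0 (lexx 0)).
move=> /cvgrPdist_le/(_ e e0)/nbhs_ballP[d /= d0 dP].
exists d => // s /andP[s0 sd]; rewrite -{2}[h](semigroup0 sgT) distrC.
by apply: dP => //; rewrite -ball_normE /= sub0r normrN ger0_norm.
Qed.

Lemma generator_subset : Cb_graph (generator T) `<=` generator S.
Proof.
move=> _ [[h k] hk <-] /=; apply/(generator_strictP cchi) => p tp e e0.
have [C C0 pC] := tight_bound tp.
have /cvgrPdist_lt/(_ (e / C)) := hk; rewrite divr_gt0// => /(_ isT)/near_right0P[d d0 dP].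
exists d => // t td; rewrite ST; last by have /andP[/ltW] := td.
apply: le_lt_trans (pC _) _; rewrite mulrC -ltr_pdivlMr//.
by have := dP t td; rewrite distrC.
Qed.

(** The mean value inequality [p (S t f - f - t g) <= t sup p (S s g - g)] is
    preserved under limits of pairs [(f, g)]. *)
Lemma closure_subset_generator :
  closure (Cb_graph (generator T)) `<=` generator S.
Proof.
move=> [f g] fg; apply/(generator_strictP cchi) => p tp e e0.
have sp := let: And3 sp _ _ := tp in sp.
have [q tq pq] := SCLE_equicontinuous cchi SC ler01 tp.
have sq := let: And3 sq _ _ := tq in sq.
have e2 : 0 < e / 2 by rewrite divr_gt0.
have [d d0 dg] := SCLE_orbit_continuous cchi SC g (lexx 0) tp e2.
exists (Num.min d 1); first by rewrite lt_min d0/=.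
move=> t; rewrite lt_min => /andP[t0 /andP[td t1]].
suff H : p (S t f - f - t *: g) <= t * (e / 2).
  have -> : t^-1 *: (S t f - f) - g = t^-1 *: (S t f - f - t *: g).
    by rewrite [RHS]scalerBr scalerA mulVf ?gt_eqF// scale1r.
  rewrite (seminorm_scale_ge0 sp) ?invr_ge0 ?(ltW t0)//.
  rewrite mulrC ltr_pdivrMr// (le_lt_trans H)// mulrC ltr_pM2r//.
  by rewrite ltr_pdivrMr// ltr_pMr// ltr1n.
apply/ler_addgt0Pr => e' e'0.
have e4 : 0 < e' / 4 by rewrite divr_gt0.
have [[f' g'] [/generator_subset fg' [/= [pf' qf'] qg']]] := fg
  ([set h | p (h - f) < e' / 4 /\ q (h - f) < e' / 4] `*` [set h | q (h - g) < e' / 4])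
  (ex_intro2 _ _ (_, _) (conj (filterI (tight_nbhs cchi f tp e4) (tight_nbhs cchi f tq e4))
    (tight_nbhs cchi g tq e4)) (@subset_refl _ _)).
have fB : p (S t f' - f' - t *: g) <= t * (e / 2 + e' / 4).
  apply: (semigroup_mean_value sgS (q := q) (g := g')) => //.
  - by move=> v s /andP[s0 st]; apply: pq; rewrite s0 (le_trans st)// ltW.
  - move=> e1 e10; have [d1 d10 dP] := (generator_strictP cchi S f' g').1 fg' q tq e1 e10.
    have [|n nP] := @inv_succ_le R (d1 / t / 2); first by rewrite !divr_gt0.
    exists n; apply: ltW; apply: dP; rewrite divr_gt0//=.
    rewrite mulrC -ltr_pdivlMr// (le_lt_trans nP)// ltr_pdivrMr// ltr_pMr ?ltr1n//.
    by rewrite divr_gt0.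
  - move=> s /andP[s0 st]; rewrite (le_trans (seminorm_dist_triangle sp (S s g) _ _))//.
    rewrite addrC lerD//.
      rewrite -[X in _ - X](semigroup0 sgS); apply: ltW; apply: dg => //.
      by rewrite subr0 ger0_norm// (le_lt_trans st).
    rewrite -(linear_mapB (semigroup_linear sgS s0)); apply: le_trans (ltW qg').
    by apply: pq; rewrite s0 (le_trans st)// ltW.
have -> : S t f - f - t *: g = (S t (f - f') - (f - f')) + (S t f' - f' - t *: g).
  rewrite (linear_mapB (semigroup_linear sgS (ltW t0))) addrA; congr (_ - _).
  by rewrite [RHS]addrAC subrKA opprB addrA subrK.
have [pD _] := sp; rewrite (le_trans (pD _ _))//.
have pf : p (S t (f - f') - (f - f')) <= e' / 2.
  rewrite (le_trans (pD _ _))// (seminormN sp) (splitr (e' / 2)) -mulrA -invfM.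
  rewrite -natrM lerD//; last by rewrite (seminorm_distC sp) ltW.
  rewrite (le_trans (pq _ _ _)) ?(ltW t0) ?(ltW t1)//.
  by rewrite (seminorm_distC sq) ltW.
have te : t * e' <= e' by rewrite ler_piMl ?ltW.
by move: pf fB te; rewrite mulrDr; move: (p _) (p _) => u v; lra.
Qed.

(** Given [(f, g)] in the generator of [S], average the orbit of [f chi_n] over
    [[0, r]]: the mean is close to [f], and its image under the generator of [T]
    is [(T r (f chi_n) - f chi_n) / r], which is close to [(S r f - f) / r] for
    large [n], hence to [g] for small [r]. *)
Lemma generator_subset_closure :
  generator S `<=` closure (Cb_graph (generator T)).
Proof.
move=> [f g] /(generator_strictP cchi) fg B [[U W] [/= fU gW] UWB].
have [p1 tp1 p1U] := strict_nbhs_tight fU.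
have [p2 tp2 p2W] := strict_nbhs_tight gW.
suff [h [k [hk [hf kg]]]] : exists h k, generator T (h, k) /\
    (p1 (C0_val h - f) < 1 /\ p2 (C0_val k - g) < 1).
  exists (C0_val h, C0_val k); split; first by exists (h, k).
  by apply: UWB; split; [exact: p1U|exact: p2W].
have sp1 := let: And3 sp _ _ := tp1 in sp.
have sp2 := let: And3 sp _ _ := tp2 in sp.
have e2 : 0 < 2^-1 :> R by [].
have e4 : 0 < 4^-1 :> R by [].
have [d1 d10 d1P] := SCLE_orbit_continuous cchi SC f (lexx 0) tp1 e4.
have [d2 d20 d2P] := fg p2 tp2 _ e2.
pose r := Num.min d1 d2 / 2.
have m0 : 0 < Num.min d1 d2 by rewrite lt_min d10.
have r0 : 0 < r by rewrite divr_gt0.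
have : r < Num.min d1 d2 by rewrite ltr_pdivrMr// ltr_pMr// ltr1n.
rewrite lt_min => /andP[rd1 rd2].
have [q1 tq1 pq1] := SCLE_equicontinuous cchi SC (ltW r0) tp1.
have [q2 tq2 pq2] := SCLE_equicontinuous cchi SC (ltW r0) tp2.
(* This seminorm bounds the errors made on both components of the pair when [f]
   is replaced by [f chi_N]. *)
have [||N NP] := @cutoff_cvg _ _ chi cchi
    (fun v => q1 v + r^-1 * (q2 v + p2 v)) f 4^-1.
- apply: tightD => //; apply: tightZ; first by rewrite invr_ge0 ltW.
  exact: tightD.
- by [].
set h := mulC0 f (chi N) in NP *; have {NP} := NP N (leqnn N); rewrite -/h => fh.
have q10 := seminorm_ge0 (let: And3 sp _ _ := tq1 in sp) (f - C0_val h).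
have q20 := seminorm_ge0 (let: And3 sp _ _ := tq2 in sp) (f - C0_val h).
have p20 := seminorm_ge0 sp2 (f - C0_val h).
have qp0 : 0 <= r^-1 * (q2 (f - C0_val h) + p2 (f - C0_val h)).
  by rewrite mulr_ge0 ?invr_ge0 ?(ltW r0)// addr_ge0.
have [k [kT kh]] := generator_average sgT
  (restriction_norm_bounded cchi SC ST) scs_continuous0 h r0.
exists k, (r^-1 *: (T r h - h)); split => //; split.
- have [C C0 pC] := tight_bound tp1.
  have [|M kM] := kh (4^-1 / C); first by rewrite divr_gt0.
  have avgS n : C0_val (dyadic_average T n (r / 2 ^+ M) h) =
      dyadic_average S n (r / 2 ^+ M) (C0_val h).
    elim: n => [//|n IH] /=; rewrite -IH ST//.
    by rewrite mulr_ge0 ?exprn_ge0// divr_ge0 ?exprn_ge0// ltW.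
  have a : p1 (C0_val (dyadic_average T M (r / 2 ^+ M) h) - f) <= 2^-1.
    rewrite avgS -[dyadic_average _ _ _ _](semigroup0 sgS).
    apply: (dyadic_average_le sgS sp1) => //.
      by rewrite divr_ge0 ?exprn_ge0// ltW.
    move=> s; rewrite add0r exprK_half => /andP[s0 sr].
    rewrite (le_trans (seminorm_dist_triangle sp1 (S s f) _ _))//.
    have -> : (2^-1 : R) = 4^-1 + 4^-1 by lra.
    rewrite lerD//.
      rewrite (seminorm_distC sp1) -(linear_mapB (semigroup_linear sgS s0)).
      rewrite (le_trans (pq1 _ _ _)) ?s0//.
      by move: fh; set x := q1 _; move: qp0; set y := r^-1 * _; lra.
    rewrite -[X in _ - X](semigroup0 sgS) ltW// d1P// subr0 ger0_norm//.
    exact: le_lt_trans rd1.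
  have b : p1 (C0_val (dyadic_average T M (r / 2 ^+ M) h) - C0_val k) <= 4^-1.
    rewrite (le_trans (pC _))// mulrC -ler_pdivlMr//.
  rewrite (le_lt_trans (seminorm_dist_triangle sp1
    (C0_val (dyadic_average T M (r / 2 ^+ M) h)) _ _))//.
  by rewrite (seminorm_distC sp1 (C0_val k)); move: a b; lra.
- have := d2P r; rewrite r0 rd2 => /(_ isT) rg.
  have [pD _] := sp2.
  have -> : C0_val (r^-1 *: (T r h - h)) - g =
      - (r^-1 *: (S r (f - C0_val h) - (f - C0_val h))) + (r^-1 *: (S r f - f) - g).
    have -> : C0_val (r^-1 *: (T r h - h)) = r^-1 *: (S r (C0_val h) - C0_val h).
      by rewrite ST// ltW.
    rewrite (linear_mapB (semigroup_linear sgS (ltW r0))) addrA; congr (_ - _).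
    rewrite -scalerN -scalerDr; congr (_ *: _).
    by rewrite opprB [RHS]addrC addrA subrKA opprB [RHS]addrC subrKA.
  rewrite (le_lt_trans (pD _ _))// (seminormN sp2).
  rewrite (seminorm_scale_ge0 sp2) ?invr_ge0 ?(ltW r0)//.
  have : r^-1 * p2 (S r (f - C0_val h) - (f - C0_val h)) <=
      r^-1 * (q2 (f - C0_val h) + p2 (f - C0_val h)).
    rewrite ler_wpM2l ?invr_ge0 ?(ltW r0)// (le_trans (pD _ _))// (seminormN sp2).
    by rewrite lerD2r pq2// lexx ltW.
  move=> H; move: fh rg q10 H.
  by move: (q1 _) (p2 (_ - g)) (r^-1 * (q2 _ + _)) (r^-1 * p2 _) => *; lra.
Qed.

End core.

(** * Strong continuity of the restriction *)

Section sliding_hump.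
Context {X : topologicalType} {R : realType}.

(** An elementary case of Mazur's theorem on convex combinations. Choose the [u i]
    one after the other, each small on a compact set outside of which the sum of
    the previous ones is small: at each point, at most one of the chosen
    functions is large. *)
Lemma sliding_hump (u : nat -> C0 X R) (M e : R) : 0 < e ->
  (forall n, `|u n| <= M) ->
  (forall K, compact K -> forall e, 0 < e -> exists n, forall x, K x -> `|u n x| <= e) ->
  exists s : seq nat, (0 < size s)%N /\ `|(size s)%:R^-1 *: \sum_(i <- s) u i| <= e.
Proof.
move=> e0 uM uK.
have e2 : 0 < e / 2 by rewrite divr_gt0.
have M0 : 0 <= M by apply: le_trans (uM 0%N).
have H m : exists s : seq nat, size s = m /\ exists2 K, compact K &
    (forall x, ~ K x -> `|(\sum_(i <- s) u i) x| <= m%:R * (e / 2)) /\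
    (forall x, `|(\sum_(i <- s) u i) x| <= m%:R * (e / 2) + M).
  elim: m => [|m [s [sm [K cK [sK sM]]]]].
    exists [::]; split => //; exists set0; first exact: compact0.
    by rewrite big_nil; split => x /=; rewrite normr0 mul0r ?add0r.
  have [n nK] := uK K cK _ e2.
  have [L cL nL] := @C0_vanish _ _ (u n) (e / 2) e2.
  exists (n :: s); split; first by rewrite /= sm.
  exists (K `|` L); first exact: compactU.
  have sE x : (\sum_(i <- n :: s) u i) x = u n x + (\sum_(i <- s) u i) x.
    by rewrite big_cons.
  rewrite -natr1 mulrDl mul1r; split => x; rewrite sE.
    move=> /not_orP[/sK Kx /nL Lx]; rewrite (le_trans (ler_normD _ _))//.
    by rewrite addrC lerD// ltW.
  rewrite (le_trans (ler_normD _ _))//; have [Kx|nKx] := pselect (K x).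
    by have := sM x; have := nK x Kx; lra.
  by have := sK x nKx; have := ler_C0_norm (u n) x; have := uM n; lra.
have [|m mM] := @inv_succ_le R (e / 2 / (M + 1)); first by rewrite divr_gt0// ltr_wpDl.
have [s [sm [K cK [_ sM]]]] := H m.+1; exists s; rewrite sm; split => //.
have m1 : 0 < (m.+1%:R : R) by [].
rewrite normrZ gtr0_norm ?invr_gt0// mulrC ler_pdivrMr//.
apply: C0_norm_le => [|x]; first by rewrite mulr_ge0// ltW.
have {}mM : M <= m.+1%:R * (e / 2).
  have : m.+1%:R^-1 * (M + 1) <= e / 2 by rewrite -ler_pdivlMr// ltr_wpDl.
  by rewrite ler_pdivrMl//; apply: le_trans; rewrite lerDl.
by have := sM x; move: mM; move: (m.+1%:R) => z; lra.
Qed.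

End sliding_hump.

Section strong_continuity.
Context {X : topologicalType} {R : realType}.
Context (chi : nat -> C0 X R) (cchi : cutoffs chi).
Context (S : R -> Cb X R -> Cb X R) (T : R -> C0 X R -> C0 X R).
Context (SC : SCLE_semigroup S) (ST : extends S T).
Implicit Types (f g : C0 X R).

Let sgS := SCLE_is_semigroup SC.

Let sgT := restriction_semigroup SC ST.

Lemma restriction_locally_uniform f t K e : 0 <= t -> compact K -> 0 < e ->
  exists2 d, 0 < d & forall s, 0 <= s -> `|s - t| < d -> forall x, K x ->
    `|T s f x - T t f x| <= e.
Proof.
move=> t0 cK e0.
have [d d0 dP] := SCLE_orbit_continuous cchi SC f t0 (sup_on_tight cK) e0.
exists d => // s s0 sd x Kx; have := dP s s0 sd; rewrite !ST// => /ltW; apply: le_trans.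
by have := sup_on_ub (C0_val (T s f) - C0_val (T t f)) Kx.
Qed.

Lemma restriction_hump f t (tn : nat -> R) M e : 0 <= t -> 0 < e ->
  (forall n, 0 <= tn n <= M) ->
  (forall d, 0 < d -> exists n, `|tn n - t| < d) ->
  exists s : seq nat, (0 < size s)%N /\
    `|(size s)%:R^-1 *: \sum_(i <- s) T (tn i) f - T t f| <= e.
Proof.
move=> t0 e0 tM tnt.
have Mt0 : 0 <= Num.max M t by rewrite le_max t0 orbT.
have [C C0 TC] := restriction_norm_bounded cchi SC ST Mt0.
have [n||s [s0 sP]] := @sliding_hump X R (fun n => T (tn n) f - T t f) (C * `|f| + C * `|f|) e e0.
- rewrite (le_trans (ler_normB _ _))// lerD// TC// le_max.
    by have /andP[-> ->] := tM n.
  by rewrite t0 lexx orbT.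
- move=> K cK e' e'0; have [d d0 dP] := restriction_locally_uniform f t0 cK e'0.
  have [n nd] := tnt d d0; exists n => x Kx.
  by apply: dP => //; have /andP[] := tM n.
exists s; split => //; move: sP; rewrite sumrB scalerBr big_const_seq count_predT.
rewrite iter_addr_0 -[T t f *+ _]scaler_nat scalerA mulVf ?scale1r//.
by rewrite pnatr_eq0 -lt0n.
Qed.

(** By [restriction_hump] it suffices to take the averages of finitely many values
    at dyadic times. *)
Lemma restriction_orbit_separable f : exists A : nat -> C0 X R,
  forall t e, 0 <= t -> 0 < e -> exists n, `|T t f - A n| <= e.
Proof.
pose avg (l : seq (nat * nat)) : C0 X R :=
  (size l)%:R^-1 *: \sum_(i <- l) T (i.1%:R / 2 ^+ i.2) f.
exists (fun n => if unpickle n is Some l then avg l else 0) => t e t0 e0.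
pose c n := (Num.truncn (t * 2 ^+ n), n).
have p2 n : 0 < (2 : R) ^+ n by rewrite exprn_gt0.
have cP n : (c n).1%:R / 2 ^+ (c n).2 <= t < (c n).1%:R / 2 ^+ (c n).2 + 1 / 2 ^+ n.
  have /truncn_itv : 0 <= t * 2 ^+ n by rewrite mulr_ge0// ltW.
  move=> /andP[a b].
  by rewrite /= -mulrDl ler_pdivrMr// ltr_pdivlMr// a natr1.
have [||s [s0 sP]] := @restriction_hump f t (fun n => (c n).1%:R / 2 ^+ (c n).2) t e t0 e0.
- by move=> m; have /andP[-> _] := cP m; rewrite divr_ge0// ltW.
- move=> d d0; have [m /(_ m (leqnn m)) md] := half_expn_small 1 d0.
  exists m; have /andP[a b] := cP m; rewrite ltr_norml.
  by move: a b md; move: (_ / _) (1 / _) => x y; move=> *; apply/andP; split; lra.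
exists (pickle (map c s)); rewrite pickleK distrC /avg size_map big_map.
exact: sP.
Qed.

(** Balls of a small radius cover the orbit by countably many closed sets of times,
    one of which contains an interval by Baire; the oscillation there propagates
    to later times. *)
Lemma restriction_right_continuous f c e : 0 < c -> 0 < e ->
  exists2 d, 0 < d & forall h, 0 <= h < d -> `|T h (T c f) - T c f| <= e.
Proof.
move=> c0 e0; have [M M0 TM] := restriction_norm_bounded cchi SC ST (ltW c0).
have e2 : 0 < e / M / 2 by rewrite !divr_gt0.
have [A AP] := restriction_orbit_separable f.
pose F n := [set t : R | `|T `|t| f - A n| <= e / M / 2].
have cF n : closed (F n).
  have -> : F n = \bigcap_(x in [set: X]) [set t : R | `|T `|t| f x - A n x| <= e / M / 2].
    apply/seteqP; split => t /=.
      by move=> Ft x _ /=; apply: le_trans Ft; exact: ler_C0_norm (T `|t| f - A n) x.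
    by move=> Ft; apply: C0_norm_le => [|x]; [exact: ltW|exact: Ft].
  apply: closed_bigI => x _.
  apply: (@closed_comp _ _ (fun t : R => `|T `|t| f x - A n x|) [set y | y <= e / M / 2]).
    move=> t _; apply: cvg_norm; apply: cvgB; last exact: cvg_cst.
    apply/cvgrPdist_le => e' e'0; apply/nbhs_ballP.
    have [d d0 dP] := restriction_locally_uniform f (normr_ge0 t) (@compact_set1 _ x) e'0.
    exists d => //= s ts; rewrite distrC; apply: dP => //.
    by rewrite (le_lt_trans (ler_dist_dist _ _))// distrC.
  exact: closed_le.
(* Any nondegenerate closed interval of times inside ]0, c[ would do. *)
pose J : set R := [set` `[c / 3, c / 2]].
have cJ : closed J by exact: interval_closed.
have [n nO] : exists n, ~ dense (~` (F n `&` J)).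
  apply/existsNP => allO.
  have /Baire dO n : open (~` (F n `&` J)) /\ dense (~` (F n `&` J)).
    by split; [apply: closed_openC; exact: closedI|exact: allO].
  have [||t [tcc tO]] := dO [set` `]c / 3, c / 2[].
  - exists (c * (5 / 12)) => /=; rewrite in_itv/=; apply/andP; split; lra.
  - exact: interval_open.
  move: tcc; rewrite /= in_itv/= => /andP[t1 t2].
  have [||n nt] := AP t (e / M / 2); [by rewrite ltW// (lt_trans _ t1)// divr_gt0|by []|].
  apply: (tO n I); split; rewrite /F /J /=.
    by rewrite gtr0_norm// (lt_trans _ t1)// divr_gt0.
  by rewrite in_itv/= !ltW.
have [U [t Ut] [oU UF]] : exists2 U, U !=set0 & open U /\ U `<=` F n `&` J.
  move: nO => /existsNP[U] /not_implyP[U0] /not_implyP[oU UO].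
  exists U => //; split => // t Ut; apply: contrapT => nt; apply: UO.
  by exists t; split.
have [_ ] := UF t Ut; rewrite /J /= in_itv/= => /andP[ct tc].
have t0 : 0 < t by rewrite (lt_le_trans _ ct)// divr_gt0.
have {}tc : t <= c by rewrite (le_trans tc)// ler_pdivrMr// ler_pMr// ler1n.
have /nbhs_ballP[d /= d0 dU] := open_nbhs_nbhs (conj oU Ut).
exists d => // h /andP[h0 hd].
have -> : T h (T c f) - T c f = T (c - t) (T (t + h) f - T t f).
  rewrite (linear_mapB (semigroup_linear sgT _)) ?subr_ge0//.
  rewrite -!(semigroupD sgT) ?subr_ge0 ?addr_ge0// ?(ltW t0)// ?(ltW c0)//.
  by rewrite addrA subrK [c + h]addrC.
rewrite (le_trans (TM _ _ _)) ?subr_ge0 ?tc ?gerBl ?(ltW t0)//.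
rewrite mulrC -ler_pdivlMr// -(subrKA (A n)) (le_trans (ler_normD _ _))//.
have inF s : `|s - t| < d -> 0 < s -> `|T s f - A n| <= e / M / 2.
  move=> sd s0; have [|] := UF s; first by apply: dU; rewrite -ball_normE /= distrC.
  by rewrite /F /= gtr0_norm.
rewrite (splitr (e / M)) lerD//; last rewrite distrC.
  by apply: inF; [rewrite addrAC subrr add0r ger0_norm|rewrite ltr_wpDr].
by apply: inF => //; rewrite subrr normr0.
Qed.

Definition right_continuous0 f := forall e, 0 < e ->
  exists2 d, 0 < d & forall h, 0 <= h < d -> `|T h f - f| <= e.

Lemma right_continuous0_sum (s : seq nat) (u : nat -> C0 X R) :
  (forall n, right_continuous0 (u n)) -> right_continuous0 (\sum_(i <- s) u i).
Proof.
move=> uP; elim: s => [|n s IH] e e0.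
  exists 1 => // h /andP[h0 _].
  by rewrite big_nil (linear_map0 (semigroup_linear sgT h0)) subrr normr0 ltW.
have e2 : 0 < e / 2 by rewrite divr_gt0.
have [d d0 dP] := uP n _ e2; have [d' d'0 dP'] := IH _ e2.
exists (Num.min d d'); first by rewrite lt_min d0.
move=> h; rewrite lt_min => /andP[h0 /andP[hd hd']].
rewrite big_cons (linear_mapD (semigroup_linear sgT h0)) opprD addrACA.
by rewrite (le_trans (ler_normD _ _))// (splitr e) lerD ?dP ?dP' ?h0.
Qed.

Lemma right_continuous0_scale a f : right_continuous0 f -> right_continuous0 (a *: f).
Proof.
move=> fP e e0; have a1 : 0 < `|a| + 1 by rewrite ltr_wpDl.
have [|d d0 dP] := fP (e / (`|a| + 1)); first by rewrite divr_gt0.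
exists d => // h hd; have [h0 _] := andP hd.
rewrite (linear_mapZ (semigroup_linear sgT h0)) -scalerBr normrZ.
have := dP h hd; rewrite ler_pdivlMr// mulrC; apply: le_trans.
by rewrite ler_wpM2r// lerDl.
Qed.

Lemma right_continuous0_closed f :
  (forall e, 0 < e -> exists2 g, right_continuous0 g & `|g - f| <= e) ->
  right_continuous0 f.
Proof.
move=> H e e0; have [M M0 TM] := restriction_norm_bounded cchi SC ST (@ler01 R).
have M1 : 0 < M + 1 by rewrite addr_gt0.
have [|g gP gf] := H (e / 2 / (M + 1)); first by rewrite !divr_gt0.
have e2 : 0 < e / 2 by rewrite divr_gt0.
have [d d0 dP] := gP _ e2; exists (Num.min d 1); first by rewrite lt_min d0/=.
move=> h; rewrite lt_min => /andP[h0 /andP[hd h1]].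
have -> : T h f - f = (T h g - g) - (T h (g - f) - (g - f)).
  by rewrite (linear_mapB (semigroup_linear sgT h0)) [- (_ - (g - f))]opprB addrA
    subrKA opprB [RHS]addrC subrKA.
rewrite (le_trans (ler_normB _ _))// (splitr e) lerD ?dP ?h0//.
rewrite (le_trans (ler_normB _ _))//.
have := TM (g - f) h; rewrite h0 (ltW h1) => /(_ isT) Th.
by move: gf; rewrite ler_pdivlMr// mulrDr mulr1 mulrC; move: Th; lra.
Qed.

(** The vectors [T c f] with [c > 0] are points of right continuity at [0]; these
    points form a closed subspace, which contains [f] as a limit of averages of
    the [T (1 / n) f]. *)
Theorem restriction_strongly_continuous : strongly_continuous_semigroup T.
Proof.
have rc0 f : right_continuous0 f.
  apply: right_continuous0_closed => e e0.
  have [||s [s0 sP]] := @restriction_hump f 0 (fun n => n.+1%:R^-1) 1 e (lexx 0) e0.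
  - by move=> n; rewrite invr_ge0 ler0n invf_le1 ?ltr0n// ler1n.
  - move=> d d0; have [|n nd] := @inv_succ_le R (d / 2); first by rewrite divr_gt0.
    exists n; rewrite subr0 ger0_norm ?invr_ge0// (le_lt_trans nd)//.
    by rewrite ltr_pdivrMr// ltr_pMr// ltr1n.
  exists ((size s)%:R^-1 *: \sum_(i <- s) T i.+1%:R^-1 f).
    apply/right_continuous0_scale/right_continuous0_sum => n e' e'0.
    by apply: restriction_right_continuous => //; rewrite invr_gt0.
  by rewrite -[X in _ - X](semigroup0 sgT).
split => //.
  move=> t t0; have [M M0 TM] := restriction_norm_bounded cchi SC ST t0; exists M => f.
  by apply: TM; rewrite t0 lexx.
move=> f; apply/subspace_continuousP => t t0; apply/cvgrPdist_le => e e0.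
have [|M M0 TM] := restriction_norm_bounded cchi SC ST (t := t + 1); first exact: addr_ge0.
have [|d d0 dP] := rc0 f (e / M); first by rewrite divr_gt0.
have key a b : 0 <= a -> a <= b -> b <= t + 1 -> b - a < d -> `|T b f - T a f| <= e.
  move=> a0 ab bt bad.
  have -> : T b f - T a f = T a (T (b - a) f - f).
    rewrite (linear_mapB (semigroup_linear sgT a0)) -(semigroupD sgT) ?subr_ge0//.
    by rewrite [a + _]addrC subrK.
  rewrite (le_trans (TM _ _ _)) ?a0 ?(le_trans ab)//.
  by rewrite mulrC -ler_pdivlMr// dP// subr_ge0 ab.
apply/nbhs_ballP; exists (Num.min d 1); first by rewrite /= lt_min d0/=.
move=> s; rewrite -ball_normE /= lt_min => /andP[sd s1] s0.
have {s0 t0} [s0 t0] : 0 <= s /\ 0 <= t by [].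
move: sd s1; have [st|/ltW ts] := leP s t.
  rewrite ger0_norm ?subr_ge0// => sd _; apply: key => //.
  by rewrite lerDl.
rewrite distrC ger0_norm ?subr_ge0// => sd s1; rewrite distrC; apply: key => //.
by rewrite -lerBlDl ltW.
Qed.

End strong_continuity.

(** * Adjoints preserving probability measures *)

Lemma metrizable_hausdorff (X : topologicalType) (R : realType) (d : X -> X -> R) :
  is_metric d -> metrizes d -> hausdorff_space X.
Proof.
move=> [d0 d1 dC dT] dn p q pq; apply/d1/eqP; rewrite eq_le d0 andbT leNgt.
apply/negP => dpq; have d2 : 0 < d p q / 2 by rewrite divr_gt0.
have [||z [/= zp zq]] := pq [set y | d p y < d p q / 2] [set y | d q y < d p q / 2].
- by rewrite dn; exists (d p q / 2).
- by rewrite dn; exists (d p q / 2).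
by have := dT p z q; rewrite (dC z q) leNgt [ltRHS]splitr ltrD.
Qed.

Section nonnegative_charges.
Context {X : topologicalType} {R : realType} (x0 : X).
Local Open Scope ereal_scope.
Implicit Types (mu : charge (borel x0) R).

Lemma open_borel (U : set X) : open U -> measurable (U : set (borel x0)).
Proof. by move=> oU; exact: sub_sigma_algebra. Qed.

Lemma closed_borel (U : set X) : closed U -> measurable (U : set (borel x0)).
Proof.
move=> cU; rewrite -(setCK U); apply: measurableC; apply: open_borel.
exact: closed_openC.
Qed.

Lemma continuous_borel_measurable (f : X -> R) : continuous f ->
  measurable_fun setT (f : borel x0 -> R).
Proof.
move=> cf; apply: (measurability _ (RGenOInfty.measurableE R)) => _ [_ [y ->] <-].
rewrite setTI; apply: open_borel; apply: open_comp => //; exact: interval_open.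
Qed.

Lemma jordan_neg_nonneg mu A : (forall A, measurable A -> 0 <= mu A) ->
  measurable A -> jordan_neg (hahn mu) A = 0.
Proof.
move=> mu0 mA; apply/eqP; rewrite eq_le measure_ge0 andbT.
have [_ [mN _] _ _] := hahn mu.
rewrite jordan_negE cjordan_negE /crestr0 mem_set// /crestr oppe_le0.
by apply: mu0; exact: measurableI.
Qed.

Lemma jordan_pos_nonneg mu A : (forall A, measurable A -> 0 <= mu A) ->
  measurable A -> jordan_pos (hahn mu) A = mu A.
Proof.
move=> mu0 mA; rewrite [RHS](jordan_decomp (hahn mu))// /cadd/=.
have /= := jordan_neg_nonneg mu0 mA.
by rewrite cscaleN1/= => ->; rewrite oppe0 adde0.
Qed.

Lemma pairing_nonneg (f : X -> R) mu : (forall A, measurable A -> 0 <= mu A) ->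
  pairing f mu = (\int[jordan_pos (hahn mu)]_x f x)%R.
Proof.
move=> mu0; rewrite /pairing [X in (_ - X)%R](_ : _ = 0%R) ?subr0//.
rewrite /Rintegral (@eq_measure_integral _ _ _ _ mzero) ?integral_measure_zero//.
by move=> A mA _; exact: jordan_neg_nonneg.
Qed.

End nonnegative_charges.

Section dirac_charges.
Context {X : topologicalType} {R : realType} (x : X).
Local Open Scope ereal_scope.

Definition dirac_charge : charge (borel x) R :=
  charge_of_finite_measure (@dirac _ (borel x) x R).

Lemma dirac_charge_ge0 (A : set (borel x)) : measurable A -> 0 <= dirac_charge A.
Proof. by move=> mA; exact: measure_ge0. Qed.

Lemma dirac_chargeE (A : set (borel x)) : dirac_charge A = \d_(x : borel x) A.
Proof. by []. Qed.

Lemma pairing_dirac (f : X -> R) : continuous f -> pairing f dirac_charge = f x.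
Proof.
move=> cf; rewrite (pairing_nonneg _ dirac_charge_ge0) /Rintegral.
rewrite (@eq_measure_integral _ _ _ _ (@dirac _ (borel x) x R)).
  rewrite integral_dirac//; last first.
    by apply/measurable_EFinP; exact: continuous_borel_measurable.
  by rewrite diracE in_setT mul1e.
move=> A mA _; exact: (jordan_pos_nonneg dirac_charge_ge0 mA).
Qed.

Lemma Prob_dirac : hausdorff_space X -> Prob dirac_charge.
Proof.
move=> hX; split; [|exact: dirac_charge_ge0|by rewrite dirac_chargeE diracE in_setT].
have varE (A : set (borel x)) : measurable A ->
    charge_variation (hahn dirac_charge) A = \d_(x : borel x) A.
  move=> mA; rewrite /charge_variation.
  rewrite (jordan_neg_nonneg dirac_charge_ge0 mA) adde0.
  exact: (jordan_pos_nonneg dirac_charge_ge0 mA).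
have mK (K : set X) : compact K -> measurable (K : set (borel x)).
  by move=> cK; apply: closed_borel; exact: compact_closed.
move=> A mA; apply/eqP; rewrite eq_le; apply/andP; split; last first.
  apply: ge_ereal_sup => _ [K [cK KA] <-].
  by rewrite !varE//; [apply: le_measure => //; rewrite inE//; exact: mK|exact: mK].
have [Ax|nAx] := pselect (A x); last first.
  rewrite varE// diracE memNset//; apply: ereal_sup_ubound; exists set0.
    by split; [exact: compact0|].
  by rewrite varE// diracE in_set0.
apply: ereal_sup_ubound; exists [set x].
  by split; [exact: compact_set1|move=> _ ->].
rewrite !varE//; last by apply: mK; exact: compact_set1.
by rewrite !diracE !mem_set.
Qed.

End dirac_charges.

Section adjoint_representation.
Context {X : topologicalType} {R : realType} (T : R -> C0 X R -> C0 X R).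
Context (hX : hausdorff_space X).
Context (aT : adjoint_preserves_Prob T).

(** Take the adjoint of a Dirac mass. It is a probability measure, hence is not
    the zero measure given as default value, and so it represents the functional
    [f |-> T t f x]. *)
Lemma adjoint_representation t x : 0 <= t ->
  exists m : {measure set (borel x) -> \bar R}, m setT = 1%E /\
    forall f : C0 X R, T t f x = \int[m]_y f y.
Proof.
move=> t0.
have [_ nu0 nu1] : Prob (adjoint (T t) (dirac_charge x)).
  by apply: (aT t0); exists (dirac_charge x) => //; exact: Prob_dirac.
move: nu0 nu1; rewrite /adjoint; case: pselect => [h|_ _]; last first.
  by rewrite /= /czero => /esym/eqP; rewrite onee_eq0.
case: cid => nu /= [_ nuT] nu0 nu1.
exists (jordan_pos (hahn nu)); split.
  exact: etrans (jordan_pos_nonneg nu0 measurableT) nu1.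
move=> f; rewrite -(pairing_nonneg f nu0) -nuT pairing_dirac//.
exact: Cb_continuous.
Qed.

Lemma adjoint_positive t x (f : C0 X R) : 0 <= t -> (forall y, 0 <= f y) -> 0 <= T t f x.
Proof.
move=> t0 f0; have [m [_ ->]] := adjoint_representation x t0.
by apply: Rintegral_ge0 => y _; exact: f0.
Qed.

(** By monotone convergence the integrals of [chi n] tend to the total mass. *)
Lemma adjoint_conservative (chi : nat -> C0 X R) t x : cutoffs chi -> 0 <= t ->
  (forall n, T t (chi n) x <= 1) /\
  forall e, 0 < e -> exists n, 1 - e <= T t (chi n) x.
Proof.
move=> [chi01 chile _ chiK] t0; have [m [m1 mE]] := adjoint_representation x t0.
have mchi n : measurable_fun setT (fun y : borel x => (chi n y)%:E).
  by apply/measurable_EFinP; apply: continuous_borel_measurable; exact: Cb_continuous.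
have chi0 n y : (0 <= (chi n y)%:E)%E by rewrite lee_fin; have /andP[] := chi01 n y.
have Ic n : (\int[m]_y (chi n y)%:E <= 1)%E.
  rewrite -m1 -[m setT]mul1e -integral_cst//; apply: ge0_le_integral => //.
  by move=> y _; rewrite lee_fin; have /andP[] := chi01 n y.
have Ifin n : (\int[m]_y (chi n y)%:E)%E = (T t (chi n) x)%:E.
  rewrite mE /Rintegral fineK// ge0_fin_numE; last exact: integral_ge0.
  by rewrite (le_lt_trans (Ic n))// ltry.
split=> [n|e e0]; first by rewrite -lee_fin -Ifin.
have chicvg y : (fun n => (chi n y)%:E) @ \oo --> 1%:E.
  have [N NP] := chiK _ (@compact_set1 _ y).
  by apply: cvg_near_cst; exists N => // n Nn; rewrite NP.
have := @cvg_monotone_convergence _ (borel x) R m setT measurableT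
  (fun n y => (chi n y)%:E) mchi (fun n y _ => chi0 n y)
  (fun y _ a b ab => chile a b ab y).
under eq_fun do rewrite Ifin.
rewrite (@eq_integral _ _ _ _ _ (cst 1%E)); last first.
  by move=> y _ /=; exact/cvg_lim/chicvg.
rewrite integral_cst// mul1e m1 => /fine_cvg /cvgrPdist_le /(_ e e0)[N _ NP].
exists N; have := NP N (leqnn N); rewrite /= ler_norml => /andP[_].
by rewrite lerBlDl -lerBlDr.
Qed.

End adjoint_representation.

(** * Extension of conservative semigroups to [Cb] *)

Section tight_split.
Context {X : topologicalType} {R : realType}.
Context (chi : nat -> C0 X R) (cchi : cutoffs chi).
Implicit Types (f g : Cb X R) (p q : Cb X R -> R).

(** Cut [f] off outside of a compact set where [p] is determined up to [e]. *)
Lemma tight_split p e : tight p -> 0 < e ->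
  exists K D, [/\ compact K, 0 < D & forall f, p f <= D * sup_on K f + e * supn f].
Proof.
move=> tp e0; have [C C0 pC] := tight_bound tp.
have [sp _ /(_ e e0)[K cK pK]] := tp; have [_ _ chis /(_ K cK)[n nK]] := cchi.
have [L cL L0] := chis n; exists L, C; split => // f.
rewrite (le_trans (seminorm_le_triangle sp f (C0_val (mulC0 f (chi n)))))// addrC lerD//.
  rewrite (le_trans (pC _))// ler_wpM2l ?(ltW C0)//.
  apply: supn_le => [|x]; first exact: sup_on_ge0.
  have [Lx|nLx] := pselect (L x).
    by rewrite (le_trans (mulC0_cutoff_le cchi f n x))// sup_on_ub.
  by rewrite mulC0E L0// mulr0 normr0 sup_on_ge0.
apply: le_trans (pK _ _) _ => [x Kx|].
  by rewrite [LHS](_ : _ = f x - mulC0 f (chi n) x)// mulC0E nK// mulr1 subrr.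
by rewrite ler_wpM2l ?(ltW e0)// cutoff_residual_le.
Qed.

(** Both sides are controlled by tight seminorms, in which [f chi n] tends to [f]. *)
Lemma eq_of_eq_on_C0 (A B : Cb X R -> Cb X R) : linear A -> linear B ->
  (forall x, exists2 q, tight q & forall f, `|A f x| <= q f) ->
  (forall x, exists2 q, tight q & forall f, `|B f x| <= q f) ->
  (forall h : C0 X R, A h = B h) -> A = B.
Proof.
move=> lA lB qA qB AB; apply/funext => f; apply: Cb_ext => x.
have [q tq Aq] := qA x; have [q' tq' Bq'] := qB x.
apply/eqP; rewrite -subr_eq0 -normr_le0; apply/ler_addgt0Pr => e e0; rewrite add0r.
have [N NP] := cutoff_cvg cchi f (tightD tq tq') e0.
have := NP N (leqnn N); set g := f - _ => qg; apply: le_trans qg.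
have -> : A f x - B f x = A g x - B g x.
  rewrite /g (linear_mapB lA) (linear_mapB lB) AB /=.
  set u := (A f) x; set v := (B f) x; set w := (B (mulC0 f (chi N))) x.
  by rewrite /= -/u -/v -/w; rewrite opprB addrA subrK.
by rewrite (le_trans (ler_normB _ _))// lerD.
Qed.

End tight_split.

Section extension.
Context {X : topologicalType} {R : realType}.
Context (chi : nat -> C0 X R) (cchi : cutoffs chi).
Context (T : R -> C0 X R -> C0 X R) (TC : strongly_continuous_semigroup T).
Context (T_pos : forall t x (h : C0 X R), 0 <= t -> (forall y, 0 <= h y) -> 0 <= T t h x).
Context (T_chi_le1 : forall t x n, 0 <= t -> T t (chi n) x <= 1).
Context (T_conservative : forall t x, 0 <= t ->
  forall e, 0 < e -> exists n, 1 - e <= T t (chi n) x).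
Implicit Types (f g : Cb X R) (h k : C0 X R) (p q : Cb X R -> R).

Let sgT : semigroup T. Proof. by case: TC. Qed.
Let lT t (t0 : 0 <= t) : linear (T t) := semigroup_linear sgT t0.

Lemma positive_le t x h k : 0 <= t -> (forall y, h y <= k y) -> T t h x <= T t k x.
Proof.
move=> t0 hk; rewrite -subr_ge0.
rewrite [leRHS](_ : _ = T t (k - h) x); last by rewrite (linear_mapB (lT t0)).
by apply: T_pos => // y; rewrite [leRHS](_ : _ = k y - h y)// subr_ge0.
Qed.

Lemma positive_norm_le t x h k : 0 <= t -> (forall y, `|h y| <= k y) ->
  `|T t h x| <= T t k x.
Proof.
move=> t0 hk; rewrite ler_norml; apply/andP; split.
  rewrite [leLHS](_ : _ = T t (- k) x); last by rewrite (linear_mapN (lT t0)).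
  apply: positive_le => // y; rewrite [leLHS](_ : _ = - k y)//.
  by have := hk y; rewrite ler_norml => /andP[].
by apply: positive_le => // y; have := hk y; rewrite ler_norml => /andP[].
Qed.

Lemma conservative_mono t x m n : 0 <= t -> (m <= n)%N ->
  T t (chi m) x <= T t (chi n) x.
Proof. by move=> t0 mn; apply: positive_le => // y; case: cchi => _ + _ _; apply. Qed.

Lemma orbit_norm_continuous h (t e : R) : 0 < e ->
  \forall s \near t, `|T `|s| h - T `|t| h| <= e.
Proof.
move=> e0; case: TC => _ _ /(_ h)/subspace_continuousP/(_ `|t| (normr_ge0 t)).
move=> /cvgrPdist_le/(_ e e0)/nbhs_ballP[d /= d0 dP].
apply/nbhs_ballP; exists d => //= s ts; rewrite distrC; apply: dP => //.
rewrite -ball_normE /= in ts *; exact: le_lt_trans (ler_dist_dist _ _) ts.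
Qed.

(** By monotonicity and conservativeness [T s (chi n) x] increases to [1]; the
    convergence is uniform on compact sets of pairs [(s, x)] as in Dini's
    theorem. *)
Lemma conservative_locally_uniform t K e : 0 <= t -> compact K -> 0 < e ->
  exists N, forall s x, 0 <= s <= t -> K x -> 1 - e <= T s (chi N) x.
Proof.
move=> t0 cK e0.
have cP : compact ([set` `[0, t]] `*` K) by apply: compact_setX => //; exact: segment_compact.
pose P n (z : R * X) := 1 - e <= T `|z.1| (chi n) z.2.
have e3 : 0 < e / 3 by rewrite divr_gt0.
have /compact_near_coveringP/(_ nat \oo P _)[|N _ NP] := cP.
  move=> [s x] _; have [N NP] := T_conservative x (normr_ge0 s) e3.
  have := orbit_norm_continuous (chi N) s e3 => sP.
  have /cvgrPdist_le/(_ _ e3) xP := @Cb_continuous _ _ (T `|s| (chi N)) x.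
  exists ([set z | `|T `|z.1| (chi N) - T `|s| (chi N)| <= e / 3 /\
     `|T `|s| (chi N) x - T `|s| (chi N) z.2| <= e / 3], [set n | (N <= n)%N]).
    split; last by exists N.
    by exists ([set u | `|T `|u| (chi N) - T `|s| (chi N)| <= e / 3],
      [set y | `|T `|s| (chi N) x - T `|s| (chi N) y| <= e / 3]).
  move=> [[u y] n] /= [[uP yP] Nn]; rewrite /P /=.
  apply: le_trans (conservative_mono y (normr_ge0 u) Nn).
  have := le_trans (ler_C0_norm (T `|u| (chi N) - T `|s| (chi N)) y) uP.
  rewrite [X in `|X|](_ : _ = T `|u| (chi N) y - T `|s| (chi N) y)//.
  move: yP NP; rewrite !ler_norml => /andP[_ ?] ? /andP[? _]; lra.
exists N => s x /andP[s0 st] Kx.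
have := NP N (leqnn N) (s, x); rewrite /P /= ger0_norm//; apply.
by split => //=; rewrite in_itv/= s0.
Qed.

(** [ |f (chi m - chi n)| ] is at most [ ||f|| (chi (m + n) - chi N) ]. *)
Lemma cutoff_orbit_cauchy t f x N m n : 0 <= t -> (N <= m)%N -> (N <= n)%N ->
  `|T t (mulC0 f (chi m)) x - T t (mulC0 f (chi n)) x| <= supn f * (1 - T t (chi N) x).
Proof.
move=> t0 Nm Nn; have [chi01 chile _ _] := cchi.
rewrite [X in `|X|](_ : _ = T t (mulC0 f (chi m) - mulC0 f (chi n)) x); last first.
  by rewrite (linear_mapB (lT t0)).
apply: (@le_trans _ _ (T t (supn f *: (chi (m + n)%N - chi N)) x)).
  apply: positive_norm_le => // y.
  rewrite [X in `|X|](_ : _ = f y * (chi m y - chi n y)); last first.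
    by rewrite mulrBr -!mulC0E.
  rewrite [leRHS](_ : _ = supn f * (chi (m + n)%N y - chi N y))//.
  rewrite normrM ler_pM ?ler_supn//.
  have := chile _ _ Nm y; have := chile _ _ Nn y.
  have := chile _ _ (leq_addr n m) y; have := chile _ _ (leq_addl m n) y.
  by rewrite ler_norml => *; apply/andP; split; lra.
rewrite (linear_mapZ (lT t0)) (linear_mapB (lT t0)).
rewrite [leLHS](_ : _ = supn f * (T t (chi (m + n)%N) x - T t (chi N) x))//.
by rewrite ler_wpM2l ?sup_on_ge0// lerB// T_chi_le1.
Qed.

Lemma cutoff_orbit_le t f x n : 0 <= t -> `|T t (mulC0 f (chi n)) x| <= supn f.
Proof.
move=> t0; apply: (@le_trans _ _ (T t (supn f *: chi n) x)).
  apply: positive_norm_le => // y; rewrite mulC0E normrM.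
  rewrite [leRHS](_ : _ = supn f * chi n y)// ler_pM ?ler_supn//.
  by case: cchi => /(_ n y)/andP[? _] _ _ _; rewrite ger0_norm.
rewrite (linear_mapZ (lT t0)) [leLHS](_ : _ = supn f * T t (chi n) x)//.
by rewrite ler_piMr ?sup_on_ge0// T_chi_le1.
Qed.

Lemma extension_exists t f : 0 <= t -> exists g, forall x N n, (N <= n)%N ->
  `|T t (mulC0 f (chi n)) x - g x| <= supn f * (1 - T t (chi N) x).
Proof.
move=> t0; have f0 : 0 <= supn f by exact: sup_on_ge0.
have f1 : 0 < supn f + 1 by rewrite ltr_wpDl.
have small x e : 0 < e -> exists N, supn f * (1 - T t (chi N) x) <= e.
  move=> e0; have [|N NP] := T_conservative x t0 (e := e / (supn f + 1)).
    by rewrite divr_gt0.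
  exists N; rewrite (@le_trans _ _ (supn f * (e / (supn f + 1))))//.
    by rewrite ler_wpM2l// lerBlDr -lerBlDl.
  by rewrite mulrCA ler_piMr ?(ltW e0)// ler_pdivrMr// mul1r lerDl.
have ptw x : cvgn (fun n => T t (mulC0 f (chi n)) x).
  apply/cauchy_cvgP/cauchy_exP => e e0.
  have [|N NP] := small x (e / 2); first by rewrite divr_gt0.
  exists (T t (mulC0 f (chi N)) x); exists N => // n /= Nn; rewrite -ball_normE /=.
  apply: le_lt_trans (cutoff_orbit_cauchy f x t0 (leqnn N) Nn) _.
  by rewrite (le_lt_trans NP)// ltr_pdivrMr// ltr_pMr// ltr1n.
pose l x : R := limn (fun n => T t (mulC0 f (chi n)) x).
have lP x N n : (N <= n)%N ->
    `|T t (mulC0 f (chi n)) x - l x| <= supn f * (1 - T t (chi N) x).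
  move=> Nn.
  have cv : `|T t (mulC0 f (chi n)) x - T t (mulC0 f (chi m)) x| @[m --> \oo] -->
      `|T t (mulC0 f (chi n)) x - l x|.
    by apply: cvg_norm; apply: cvgB; [exact: cvg_cst|exact: ptw].
  by apply: (cvgr_to_le cv); exists N => // m /= Nm; exact: cutoff_orbit_cauchy.
have [g gE] : exists g : Cb X R, forall x, g x = l x.
  apply: Cb_exists.
  - apply: locally_uniform_limit_continuous => x e e0.
    have [|N NP] := T_conservative x t0 (e := e / (supn f + 1) / 2).
      by rewrite !divr_gt0.
    exists (T t (mulC0 f (chi N))); first exact: Cb_continuous.
    have /cvgrPdist_le/(_ (e / (supn f + 1) / 2)) := @Cb_continuous _ _ (T t (chi N)) x.
    rewrite !divr_gt0// => /(_ isT); apply: filterS => y yP.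
    rewrite distrC (le_trans (lP y N N (leqnn N)))//.
    rewrite (@le_trans _ _ (supn f * (e / (supn f + 1))))//.
      rewrite ler_wpM2l//; move: yP NP; rewrite ler_norml => /andP[_].
      by set z := e / _; lra.
    by rewrite mulrCA ler_piMr ?(ltW e0)// ler_pdivrMr// mul1r lerDl.
  - exists (supn f) => x; have cv : `|T t (mulC0 f (chi m)) x| @[m --> \oo] --> `|l x|.
      by apply: cvg_norm; exact: ptw.
    by apply: (cvgr_to_le cv); exists 0%N => // m _; exact: cutoff_orbit_le.
by exists g => x N n Nn; rewrite gE; exact: lP.
Qed.

(** The error bound is small uniformly on compact sets of pairs [(t, x)], by
    [conservative_locally_uniform]. *)
Lemma extension_family_exists : exists S : R -> Cb X R -> Cb X R,
  forall t, 0 <= t -> forall f x N n, (N <= n)%N ->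
  `|T t (mulC0 f (chi n)) x - S t f x| <= supn f * (1 - T t (chi N) x).
Proof.
have /choice[S SP] (z : R * Cb X R) : exists g, 0 <= z.1 -> forall x N n, (N <= n)%N ->
  `|T z.1 (mulC0 z.2 (chi n)) x - g x| <= supn z.2 * (1 - T z.1 (chi N) x).
  have [z0|z0] := leP 0 z.1; last by exists 0.
  by have [g gP] := extension_exists z.2 z0; exists g.
by exists (fun t f => S (t, f)) => t t0 f; exact: (SP (t, f) t0).
Qed.

Context (S : R -> Cb X R -> Cb X R).
Context (SP : forall t, 0 <= t -> forall f x N n, (N <= n)%N ->
  `|T t (mulC0 f (chi n)) x - S t f x| <= supn f * (1 - T t (chi N) x)).

Lemma extension_approx t f x : 0 <= t -> T t (mulC0 f (chi n)) x @[n --> \oo] --> S t f x.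
Proof.
move=> t0; apply/cvgrPdist_le => e e0.
have f1 : 0 < supn f + 1 by rewrite ltr_wpDl// sup_on_ge0.
have [|N NP] := T_conservative x t0 (e := e / (supn f + 1)); first by rewrite divr_gt0.
exists N => // n /= Nn; rewrite distrC (le_trans (SP t0 f x Nn))//.
rewrite (@le_trans _ _ (supn f * (e / (supn f + 1))))//.
  by rewrite ler_wpM2l ?sup_on_ge0// lerBlDr -lerBlDl.
by rewrite mulrCA ler_piMr ?(ltW e0)// ler_pdivrMr// mul1r lerDl.
Qed.

Lemma extension_contraction t f : 0 <= t -> supn (S t f) <= supn f.
Proof.
move=> t0; apply: supn_le => [|x]; first exact: sup_on_ge0.
have cv : `|T t (mulC0 f (chi m)) x| @[m --> \oo] --> `|S t f x|.
  by apply: cvg_norm; exact: extension_approx.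
by apply: (cvgr_to_le cv); exists 0%N => // m _; exact: cutoff_orbit_le.
Qed.

Lemma extension_linear t : 0 <= t -> linear (S t).
Proof.
move=> t0 a f g; apply: Cb_ext => x.
have H1 := @extension_approx _ (a *: f + g) x t0.
have H2 : T t (mulC0 (a *: f + g) (chi n)) x @[n --> \oo] --> a * S t f x + S t g x.
  have -> : (fun n => T t (mulC0 (a *: f + g) (chi n)) x) =
      (fun n => a * T t (mulC0 f (chi n)) x + T t (mulC0 g (chi n)) x).
    apply/funext => n.
    have -> : mulC0 (a *: f + g) (chi n) = a *: mulC0 f (chi n) + mulC0 g (chi n).
      apply: C0_ext => y; rewrite mulC0E.
      rewrite [RHS](_ : _ = a * mulC0 f (chi n) y + mulC0 g (chi n) y)// !mulC0E.
      by rewrite [(a *: f + g) y](_ : _ = a * f y + g y)// mulrDl mulrA.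
    by rewrite (lT t0).
  by apply: cvgD; [apply: cvgMr; exact: extension_approx|exact: extension_approx].
exact: (cvg_unique _ H1 H2).
Qed.

Lemma extension_extends : extends S T.
Proof.
move=> t t0 h; apply: Cb_ext => x; apply/esym/eqP.
rewrite -subr_eq0 -normr_le0; apply/ler_addgt0Pr => e e0; rewrite add0r.
case: TC => _ /(_ t t0)[M TM] _.
have M1 : 0 < `|M| + 1 by rewrite ltr_wpDl.
have e2 : 0 < e / 2 by rewrite divr_gt0.
have [|K cK hK] := @C0_vanish _ _ h (e / 2 / (`|M| + 1)); first by rewrite divr_gt0.
have [chi01 _ _ /(_ K cK)[N NK]] := cchi.
have /cvgrPdist_le/(_ _ e2)[N' _ NP'] := @extension_approx _ h x t0.
pose n := maxn N N'.
have A := NP' n (leq_maxr _ _).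
have B : `|T t h x - T t (mulC0 h (chi n)) x| <= e / 2.
  rewrite [X in `|X|](_ : _ = T t (h - mulC0 h (chi n)) x); last first.
    by rewrite (linear_mapB (lT t0)).
  rewrite (le_trans (ler_C0_norm _ _))// (le_trans (TM _))//.
  have v0 : 0 <= e / 2 / (`|M| + 1) by rewrite divr_ge0 ?(ltW e2) ?(ltW M1).
  have hn : `|h - mulC0 h (chi n)| <= e / 2 / (`|M| + 1).
    apply: C0_norm_le => // y.
    rewrite [X in `|X|](_ : _ = h y * (1 - chi n y)); last first.
      by rewrite mulrBr mulr1 -mulC0E.
    have [Ky|/hK hy] := pselect (K y).
      by rewrite NK ?leq_maxl// subrr mulr0 normr0.
    have /andP[? ?] := chi01 n y.
    rewrite normrM (le_trans _ (ltW hy))// ler_piMr// ger0_norm ?subr_ge0//.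
    by rewrite lerBlDr lerDl.
  apply: (@le_trans _ _ ((`|M| + 1) * `|h - mulC0 h (chi n)|)).
    by rewrite ler_wpM2r// ler_wpDr// ler_norm.
  by rewrite mulrC -ler_pdivlMr.
rewrite -(subrKA (T t (mulC0 h (chi n)) x)) (le_trans (ler_normD _ _))//.
by rewrite (splitr e) lerD// distrC.
Qed.

Let ST := extension_extends.

(** The supremum of [p (S s f)] over [s <= t] is tight: if [g] vanishes on a
    support of [chi N], then [S s g] is at most [ ||g|| (1 - T s (chi N)) ], which
    is small uniformly on a compact set that determines [p] up to a small
    multiple of the norm. *)
Lemma extension_equicontinuous t p : 0 <= t -> tight p ->
  exists2 q, tight q & forall f s, 0 <= s <= t -> p (S s f) <= q f.
Proof.
move=> t0 tp; have [C C0 pC] := tight_bound tp.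
have [sp _ _] := tp; have [pD pZ] := sp.
pose V f := [set p (S s f) | s in [set s | 0 <= s <= t]].
have V0 f : V f !=set0 by exists (p (S 0 f)), 0; rewrite //= lexx.
have Vub f : ubound (V f) (C * supn f).
  move=> _ [s /andP[s0 _] <-]; rewrite (le_trans (pC _))// ler_wpM2l ?(ltW C0)//.
  exact: extension_contraction.
pose q f := sup (V f).
have pq f s : 0 <= s <= t -> p (S s f) <= q f.
  by move=> st; apply: ub_le_sup; [exists (C * supn f); exact: Vub|exists s].
have qle f M : (forall s, 0 <= s <= t -> p (S s f) <= M) -> q f <= M.
  by move=> H; apply: ge_sup => // _ [s st <-]; exact: H.
have qZ (c : R) f : q (c *: f) <= `|c| * q f.
  apply: qle => s st; have [s0 _] := andP st.
  by rewrite (linear_mapZ (extension_linear s0)) pZ ler_wpM2l// pq.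
exists q => //; split; first split.
- move=> f g; apply: qle => s st; have [s0 _] := andP st.
  rewrite (linear_mapD (extension_linear s0)) (le_trans (pD _ _))//.
  by rewrite lerD// pq.
- move=> c f; apply/eqP; rewrite eq_le qZ/=; have [->|c0] := eqVneq c 0.
    rewrite normr0 mul0r (le_trans _ (pq _ 0 _)) ?lexx//.
    by apply: seminorm_ge0.
  rewrite mulrC -ler_pdivlMr ?normr_gt0// mulrC -normfV.
  by rewrite (le_trans _ (qZ _ _))// scalerK.
- by exists C => f; apply: qle => s st; apply: (Vub f); exists s.
move=> e e0; have e2 : 0 < e / 2 by rewrite divr_gt0.
have [K [D [cK D0 pKD]]] := tight_split cchi tp e2.
have [|N NP] := conservative_locally_uniform t0 cK (e := e / 2 / D).
  by rewrite divr_gt0.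
have [_ _ /(_ N)[L cL L0] _] := cchi; exists L => // g gL.
have g0 : mulC0 g (chi N) = 0.
  apply: C0_ext => x; rewrite mulC0E; have [Lx|nLx] := pselect (L x).
    by rewrite gL// mul0r.
  by rewrite L0// mulr0.
have sg : 0 <= supn g by exact: sup_on_ge0.
apply: qle => s st; have [s0 _] := andP st.
rewrite (le_trans (pKD _))// [X in _ <= X * _](splitr e) mulrDl lerD//; last first.
  by rewrite ler_wpM2l ?(ltW e2)// extension_contraction.
rewrite -ler_pdivlMl//; apply: sup_on_le => [|x Kx].
  by rewrite !mulr_ge0 ?invr_ge0// ltW.
have := SP s0 g x (leqnn N); rewrite g0 (linear_map0 (lT s0)) sub0r normrN.
move=> /le_trans; apply; rewrite mulrC mulrA ler_wpM2r//.
by have := NP s x st Kx; rewrite [D^-1 * _]mulrC; lra.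
Qed.

Lemma extension_semigroup : semigroup S.
Proof.
split; first exact: extension_linear.
- apply/funext => f; apply: Cb_ext => x.
  have H1 := @extension_approx _ f x (lexx 0).
  have H2 : T 0 (mulC0 f (chi n)) x @[n --> \oo] --> f x.
    apply: cvg_near_cst; have [_ _ _ /(_ _ (@compact_set1 _ x))[N NP]] := cchi.
    by exists N => // n Nn; rewrite (semigroup0 sgT) mulC0E NP// mulr1.
  exact: (cvg_unique _ H1 H2).
- move=> s t s0 t0; apply: (eq_of_eq_on_C0 cchi).
  + by move=> a f g /=; rewrite !extension_linear.
  + exact/extension_linear/addr_ge0.
  + move=> x; have [q1 tq1 Hq1] := extension_equicontinuous t0 (eval_tight x).
    have [q2 tq2 Hq2] := extension_equicontinuous s0 tq1; exists q2 => // f /=.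
    by rewrite (le_trans (Hq1 _ _ _)) ?t0 ?lexx// Hq2// s0 lexx.
  + move=> x; have [q tq Hq] := extension_equicontinuous (addr_ge0 t0 s0) (eval_tight x).
    by exists q => // f; apply: Hq; rewrite addr_ge0/=.
  + move=> h /=; rewrite !ST ?addr_ge0//.
    by rewrite (semigroupD sgT).
Qed.

Lemma extension_SCLE : SCLE_semigroup S.
Proof.
split; first exact: extension_semigroup.
- move=> t t0 f; apply/(cvg_strictP cchi _ _ (nbhs_filter f)) => p tp e e0.
  have [q tq pq] := extension_equicontinuous t0 tp.
  have := tight_nbhs cchi f tq e0; apply: (@filterS _ _ (nbhs_filter _)) => g /=.
  apply: le_lt_trans; rewrite -(linear_mapB (extension_linear t0)).
  by apply: pq; rewrite t0 lexx.
- move=> f; apply/subspace_continuousP => t t0; apply/(cvg_strictP cchi) => p tp e e0.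
  have sp := let: And3 sp _ _ := tp in sp.
  have t1 : 0 <= t + 1 by exact: addr_ge0.
  have [q tq pq] := extension_equicontinuous t1 tp.
  have [C C0 pC] := tight_bound tp.
  have e4 : 0 < e / 4 by rewrite divr_gt0.
  have [N NP] := cutoff_cvg cchi f tq e4; set h := mulC0 f (chi N).
  have fh : q (f - C0_val h) <= e / 4 := NP N (leqnn N).
  have e4C : 0 < e / 4 / C by rewrite divr_gt0.
  have /nbhs_ballP[d /= d0 dP] := orbit_norm_continuous h t e4C.
  apply/nbhs_ballP; exists (Num.min d 1); first by rewrite /= lt_min d0/=.
  move=> s ts s0; have {s0 t0} [s0 t0] : 0 <= s /\ 0 <= t by [].
  have := ts; rewrite -ball_normE /= lt_min => /andP[sd s1].
  have st : s <= t + 1 by move: s1; rewrite ltr_norml => /andP[? ?]; lra.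
  have tt : t <= t + 1 by rewrite lerDl.
  have := dP s; rewrite -ball_normE /= => /(_ sd); rewrite !ger0_norm// => Th.
  rewrite (le_lt_trans (seminorm_dist_triangle sp (S s (C0_val h)) _ _))//.
  have A : p (S s f - S s (C0_val h)) <= e / 4.
    rewrite -(linear_mapB (extension_linear s0)); apply: le_trans fh.
    by apply: pq; rewrite s0.
  have B : p (S t (C0_val h) - S t f) <= e / 4.
    rewrite -(linear_mapB (extension_linear t0)); apply: le_trans fh.
    rewrite (seminorm_distC (let: And3 sq _ _ := tq in sq) f).
    by apply: pq; rewrite t0.
  have D : p (S s (C0_val h) - S t (C0_val h)) <= e / 4.
    rewrite !ST//; apply: le_trans (pC _) _.
    by rewrite mulrC -ler_pdivlMr.
  have := seminorm_dist_triangle sp (S t (C0_val h)) (S s (C0_val h)) (S t f).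
  by move: A B D e0; move: (p _) (p _) (p _) (p _) => *; lra.
- move=> t t0 p sp cp; have tp := continuous_tight sp cp.
  have [q tq pq] := extension_equicontinuous t0 tp.
  exists q; split => //; first by case: tq.
  exact (tight_continuous cchi tq).
Qed.

End extension.

Lemma SCLE_extension_unique (X : topologicalType) (R : realType)
    (chi : nat -> C0 X R) (S S' : R -> Cb X R -> Cb X R) (T : R -> C0 X R -> C0 X R) t :
  cutoffs chi -> SCLE_semigroup S -> SCLE_semigroup S' ->
  extends S T -> extends S' T -> 0 <= t -> S' t = S t.
Proof.
move=> cchi SC SC' ST ST' t0; apply: (eq_of_eq_on_C0 cchi).
- exact: semigroup_linear (SCLE_is_semigroup SC') _ t0.
- exact: semigroup_linear (SCLE_is_semigroup SC) _ t0.
- move=> x; have [q tq qP] := SCLE_equicontinuous cchi SC' t0 (eval_tight x).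
  by exists q => // f; apply: qP; rewrite t0 lexx.
- move=> x; have [q tq qP] := SCLE_equicontinuous cchi SC t0 (eval_tight x).
  by exists q => // f; apply: qP; rewrite t0 lexx.
- by move=> h; rewrite ST ?ST'.
Qed.

(** * The theorem *)

Theorem theorem4p1 (R : realType) (X : topologicalType)
    (X_polish : polish_space R X) (X_lc : locally_compact [set: X]) :
  [/\ (forall S : R -> Cb X R -> Cb X R,
        SCLE_semigroup S -> preserves_C0 S ->
        strongly_continuous_semigroup (C0_restriction S)),
      (forall T : R -> C0 X R -> C0 X R,
        strongly_continuous_semigroup T -> adjoint_preserves_Prob T ->
        exists S : R -> Cb X R -> Cb X R,
          [/\ SCLE_semigroup S, extends S T &
              forall S' : R -> Cb X R -> Cb X R,
                SCLE_semigroup S' -> extends S' T ->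
                forall t, 0 <= t -> S' t = S t]) &
      (forall (S : R -> Cb X R -> Cb X R) (T : R -> C0 X R -> C0 X R),
        ([/\ SCLE_semigroup S, preserves_C0 S & T = C0_restriction S] \/
         [/\ strongly_continuous_semigroup T, adjoint_preserves_Prob T,
             SCLE_semigroup S & extends S T]) ->
        Cb_graph (generator T) `<=` generator S /\
        generator S = closure (Cb_graph (generator T)))].
Proof.
have [chi cchi] := cutoffs_exist X_polish X_lc.
have hX : hausdorff_space X.
  by have [_ [d [dm dn _]]] := X_polish; exact: metrizable_hausdorff dm dn.
have part1 (S : R -> Cb X R -> Cb X R) : SCLE_semigroup S -> preserves_C0 S ->
    strongly_continuous_semigroup (C0_restriction S).
  move=> SC /C0_restriction_extends ST.
  exact: (restriction_strongly_continuous cchi SC ST).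
split => //.
- move=> T TC aT.
  have T_pos t x (h : C0 X R) : 0 <= t -> (forall y, 0 <= h y) -> 0 <= T t h x.
    by move=> t0 h0; exact: (adjoint_positive hX aT).
  have T_le1 t x n : 0 <= t -> T t (chi n) x <= 1.
    by move=> t0; exact: (adjoint_conservative hX aT x cchi t0).1.
  have T_cons t x : 0 <= t -> forall e, 0 < e -> exists n, 1 - e <= T t (chi n) x.
    by move=> t0; exact: (adjoint_conservative hX aT x cchi t0).2.
  have [S SP] := extension_family_exists cchi TC T_pos T_le1 T_cons.
  have SC := extension_SCLE cchi TC T_pos T_le1 T_cons SP.
  have ST := extension_extends cchi TC T_cons SP.
  exists S; split => // S' SC' ST' t t0.
  exact: (SCLE_extension_unique cchi SC SC' ST ST' t0).
- move=> S T H.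
  have [SC TC ST] : [/\ SCLE_semigroup S, strongly_continuous_semigroup T & extends S T].
    case: H => [[SC S0 ->]|[TC _ SC ST]]; split => //; first exact: part1.
    exact: C0_restriction_extends.
  split; first exact (generator_subset cchi ST).
  apply/seteqP; split; first exact (generator_subset_closure cchi SC TC ST).
  exact (closure_subset_generator cchi SC ST).
Qed.
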